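(* For every dense subring $A$ of $\mathbb{R}$, the group $H(A)$ of piecewise $PSL_2(A)$ homeomorphisms of the real line has Tarski number at most $25$. Moreover, both of the (finitely presented, nonamenable) Lodha--Moore groups $G_0$ and $G$ have Tarski number at most $25$.
   Context: Tarski number. A paradoxical decomposition of a group $\Lambda$ consists of a partition of $\Lambda$ into pairwise disjoint subsets $S_1,\dots,S_n,T_1,\dots,T_m$ together with elements $s_1,\dots,s_n,t_1,\dots,t_m\in \Lambda$ such that $\Lambda=\bigcup_{1\le i\le n}s_iS_i=\bigcup_{1\le i\le m}t_iT_i$. The number of pieces is $n+m$. The Tarski number of a nonamenable group is the smallest number of pieces of a paradoxical decomposition of the group. The groups $H(A)$. Subrings of $\mathbb{R}$ contain $1$. For a subring $A$ of $\mathbb{R}$, let $PSL_2(A)$ act on $P^1(\mathbb{R})=\mathbb{R}\cup\{\infty\}$ by fractional linear transformations, and let $P_A\subset P^1(\mathbb{R})$ be the set of all fixed points of hyperbolic elements of $PSL_2(A)$ (elements with $|\mathrm{trace}|>2$). A homeomorphism of $P^1(\mathbb{R})$ is piecewise $PSL_2(A)$ (with endpoints in $P_A$) if $P^1(\mathbb{R})$ can be covered by finitely many closed intervals with endpoints in $P_A$ (or the single interval $P^1(\mathbb{R})$ itself, with no endpoints) on each of which the homeomorphism coincides with an element of $PSL_2(A)$. $H(A)$ is the group of all such homeomorphisms that fix $\infty$; it is viewed as a group of homeomorphisms of $\mathbb{R}$. The groups $G_0$ and $G$. $G_0=\langle a,b,c\rangle$ is the group of homeomorphisms of $\mathbb{R}$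 generated by: $a(t)=t+1$; $b(t)=t$ for $t\le 0$, $b(t)=\frac{t}{1-t}$ for $0\le t\le \frac12$, $b(t)=3-\frac1t$ for $\frac12\le t\le 1$, $b(t)=t+1$ for $t\ge 1$; and $c(t)=\frac{2t}{1+t}$ for $0\le t\le 1$, $c(t)=t$ otherwise. $G$ is the group of homeomorphisms of $\mathbb{R}$ generated by $G_0$ together with the two maps $d,e$ given by $d(t)=2t$ for $t\ge 0$, $d(t)=t$ for $t\le 0$, and $e(t)=\frac t2$ for $t\le 0$, $e(t)=t$ for $t\ge 0$. *)

(* Defs.v *)
From HB Require Import structures.
From mathcomp Require Import all_boot all_order all_algebra.
From mathcomp Require Import all_classical all_reals all_analysis.
From mathcomp Require Import lra ring.

Set Implicit Arguments.
Unset Strict Implicit.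
Unset Printing Implicit Defensive.

Import Order.TTheory GRing.Theory Num.Theory.
Import numFieldNormedType.Exports.

Local Open Scope classical_set_scope.
Local Open Scope ring_scope.

Section Tarski.
Variable G : groupType.
Implicit Types (X L : set G).

Definition subgroup L : Prop :=
  L 1%g /\ forall x y, L x -> L y -> L (x * y^-1)%g.

Definition generated X : set G := smallest subgroup X.

Lemma generated_subgroup X : subgroup (generated X).
Proof.
split=> [L [[L1 _] _]//|x y xX yX L [Lgrp XL]].
by apply: Lgrp.2; [apply: xX | apply: yX].
Qed.

(* The group is a subgroup [L] of the ambient group [G]: the pieces are subsets
   of [L] and the translating elements belong to [L].  Empty pieces are
   allowed; they can be discarded, so they do not affect the Tarski number. *)
Definition paradoxical L (n m : nat) : Prop :=
  exists (S : 'I_n -> set G) (T : 'I_m -> set G) (s : 'I_n -> G) (t : 'I_m -> G),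
  [/\ trivIset [set: 'I_n] S, trivIset [set: 'I_m] T,
      forall i j, S i `&` T j = set0
    & (\bigcup_i S i) `|` (\bigcup_j T j) = L] /\
  [/\ forall i, L (s i), forall j, L (t j),
      \bigcup_i [set (s i * x)%g | x in S i] = L
    & \bigcup_j [set (t j * x)%g | x in T j] = L].

(* An amenable group has no paradoxical decomposition, and then no [k]
   satisfies [is_tarski_number L k]. *)
Definition is_tarski_number L (k : nat) : Prop :=
  (exists n m, paradoxical L n m /\ k = (n + m)%N) /\
  (forall n m, paradoxical L n m -> (k <= n + m)%N).

End Tarski.

Record homeo (T : topologicalType) := Homeo {
  homeo_fun :> T -> T;
  homeo_inv : T -> T;
  homeo_funK : cancel homeo_fun homeo_inv;
  homeo_invK : cancel homeo_inv homeo_fun;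
  homeo_fun_continuous : continuous homeo_fun;
  homeo_inv_continuous : continuous homeo_inv
}.

Section HomeoGroup.
Variable T : topologicalType.
Implicit Types f g h : homeo T.

Lemma homeoP f g : f =1 g -> f = g.
Proof.
case: f g => [f f' fK f'K cf cf'] [g g' gK g'K cg cg'] /= /funext fg.
have f'g' : f' = g' by apply/funext => x; rewrite -[x in LHS]g'K -fg fK.
by subst g g'; congr Homeo; exact: Prop_irrelevance.
Qed.

Definition homeo_id : homeo T :=
  @Homeo T id id (frefl _) (frefl _) (fun=> cvg_id) (fun=> cvg_id).

Definition homeo_comp f g : homeo T :=
  @Homeo T (f \o g) (homeo_inv g \o homeo_inv f)
    (can_comp (homeo_funK f) (homeo_funK g))
    (can_comp (homeo_invK g) (homeo_invK f))
    (fun x => @continuous_comp _ _ _ g f x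
       (@homeo_fun_continuous _ g x) (@homeo_fun_continuous _ f (g x)))
    (fun x => @continuous_comp _ _ _ (homeo_inv f) (homeo_inv g) x
       (@homeo_inv_continuous _ f x) (@homeo_inv_continuous _ g _)).

Definition homeo_sym f : homeo T :=
  @Homeo T (homeo_inv f) f (homeo_invK f) (homeo_funK f)
    (@homeo_inv_continuous _ f) (@homeo_fun_continuous _ f).

Lemma homeo_compA : associative homeo_comp.
Proof. by move=> f g h; apply: homeoP. Qed.

Lemma homeo_comp1 : left_id homeo_id homeo_comp.
Proof. by move=> f; apply: homeoP. Qed.

Lemma homeo_comp1r : right_id homeo_id homeo_comp.
Proof. by move=> f; apply: homeoP. Qed.

Lemma homeo_compV : left_inverse homeo_id homeo_sym homeo_comp.
Proof. by move=> f; apply: homeoP => x; exact: homeo_funK. Qed.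

Lemma homeo_compVr : right_inverse homeo_id homeo_sym homeo_comp.
Proof. by move=> f; apply: homeoP => x; exact: homeo_invK. Qed.

HB.instance Definition _ := gen_eqMixin (homeo T).
HB.instance Definition _ := gen_choiceMixin (homeo T).
HB.instance Definition _ := isGroup.Build (homeo T)
  homeo_compA homeo_comp1 homeo_comp1r homeo_compV homeo_compVr.

End HomeoGroup.

Section PiecewiseProjective.
Variable R : realType.

(* [None] is the point at infinity. *)
Definition P1 := one_point_compactification R.

(* An element of PSL_2(A) is represented by either of its two lifts to SL_2(A):
   the action on P^1 and |trace| do not depend on the lift. *)
Definition SL2 (A : {pred R}) : set 'M[R]_2 :=
  [set M | M \is a mxOver A /\ \det M = 1].

Definition mobius (M : 'M[R]_2) (z : P1) : P1 :=
  match z with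
  | Some x => if M 1 0 * x + M 1 1 == 0 then None
              else Some ((M 0 0 * x + M 0 1) / (M 1 0 * x + M 1 1))
  | None => if M 1 0 == 0 then None else Some (M 0 0 / M 1 0)
  end.

Definition hyperbolic (M : 'M[R]_2) : Prop := 2 < `|\tr M|.

Definition PA (A : {pred R}) : set P1 :=
  [set z | exists M, [/\ SL2 A M, hyperbolic M & mobius M z = z]].

(* The closed arc swept out when going from [p] to [q] in the direction of
   increasing reals; it contains infinity when [p = Some x], [q = Some y] and
   [y < x]. *)
Definition arc (p q : P1) : set P1 :=
  match p, q with
  | Some x, Some y =>
      if x <= y then [set Some t | t in [set t | x <= t <= y]]
      else [set None] `|` [set Some t | t in [set t | (x <= t) || (t <= y)]]
  | Some x, None => [set None] `|` [set Some t | t in [set t | x <= t]]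
  | None, Some y => [set None] `|` [set Some t | t in [set t | t <= y]]
  | None, None => [set None]
  end.

Definition closed_interval (E I : set P1) : Prop :=
  I = [set: P1] \/ exists p q, [/\ E p, E q, p != q & I = arc p q].

Definition piecewise_PSL2 (A : {pred R}) (f : homeo P1) : Prop :=
  exists (n : nat) (I : 'I_n -> set P1) (M : 'I_n -> 'M[R]_2),
  [/\ forall i, closed_interval (PA A) (I i),
      \bigcup_i I i = [set: P1],
      forall i, SL2 A (M i)
    & forall i z, I i z -> f z = mobius (M i) z].

(* The restrictions to the real line of the piecewise PSL_2(A) homeomorphisms
   of P^1 that fix infinity. *)
Definition Hgroup (A : {pred R}) : set (homeo R) :=
  [set h : homeo R | exists f : homeo P1,
     [/\ piecewise_PSL2 A f, f None = None & forall x, f (Some x) = Some (h x)]].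

End PiecewiseProjective.

Section LodhaMoore.
Variable R : realType.

Lemma incr_bij_continuous (f g : R -> R) : cancel f g -> cancel g f ->
  {homo f : x y / x < y} -> continuous f.
Proof.
move=> fK gK f_incr x.
have f_mono : {mono f : x y / x < y} by exact: leW_mono (le_mono f_incr).
apply/cvgrPdist_lt => e e0; near=> y; rewrite distrC ltr_distl.
apply/andP; split.
- rewrite -[X in X < _]gK f_mono; near: y.
  by apply: lt_nbhsr; rewrite -f_mono gK; lra.
- rewrite -[X in _ < X]gK f_mono; near: y.
  by apply: lt_nbhsl; rewrite -f_mono gK; lra.
Unshelve. all: by end_near. Qed.

Lemma incr_bij_inv (f g : R -> R) : cancel g f ->
  {homo f : x y / x < y} -> {homo g : x y / x < y}.
Proof.
move=> gK f_incr x y xy; have f_mono := leW_mono (le_mono f_incr).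
by rewrite -f_mono !gK.
Qed.

Definition incr_homeo (f g : R -> R) (fK : cancel f g) (gK : cancel g f)
    (f_incr : {homo f : x y / x < y}) : homeo R :=
  Homeo fK gK (incr_bij_continuous fK gK f_incr)
    (incr_bij_continuous gK fK (incr_bij_inv gK f_incr)).

Definition a_fun (t : R) : R := t + 1.
Definition a_inv (t : R) : R := t - 1.

Definition b_fun (t : R) : R :=
  if t <= 0 then t
  else if t <= 2^-1 then t / (1 - t)
  else if t <= 1 then 3 - t^-1
  else t + 1.
Definition b_inv (t : R) : R :=
  if t <= 0 then t
  else if t <= 1 then t / (1 + t)
  else if t <= 2 then (3 - t)^-1
  else t - 1.

Definition c_fun (t : R) : R := if 0 <= t <= 1 then 2 * t / (1 + t) else t.
Definition c_inv (t : R) : R := if 0 <= t <= 1 then t / (2 - t) else t.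

Definition d_fun (t : R) : R := if 0 <= t then 2 * t else t.
Definition d_inv (t : R) : R := if 0 <= t then t / 2 else t.

Definition e_fun (t : R) : R := if t <= 0 then t / 2 else t.
Definition e_inv (t : R) : R := if t <= 0 then 2 * t else t.

Lemma a_funK : cancel a_fun a_inv. Proof. by move=> t; exact: addrK. Qed.
Lemma a_invK : cancel a_inv a_fun. Proof. by move=> t; exact: subrK. Qed.
Lemma a_incr : {homo a_fun : x y / x < y}.
Proof. by move=> x y; rewrite /a_fun ltrD2r. Qed.

Lemma b_incr : {homo b_fun : x y / x < y}.
Proof.
have mid (x : R) : 0 < x -> x <= 2^-1 -> 0 < x / (1 - x) <= 1.
  by move=> x0 x1; rewrite divr_gt0 ?ler_pdivrMr; lra.
have top (x : R) : 2^-1 < x -> x <= 1 -> 1 < 3 - x^-1 <= 2.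
  move=> x0 x1; have : x^-1 * x = 1 by rewrite mulVf //; lra.
  have : 0 < x^-1 by rewrite invr_gt0; lra.
  by move=> ? ?; apply/andP; split; nra.
move=> x y xy; rewrite /b_fun.
case: (leP x 0) => x0; case: (leP y 0) => y0; try lra.
  case: (leP y 2^-1) => y2; first by have := mid _ y0 y2; lra.
  by case: (leP y 1) => y1; [have := top _ y2 y1|]; lra.
case: (leP x 2^-1) => x2; case: (leP y 2^-1) => y2; try lra.
- by rewrite ltr_pdivrMr 1?mulrAC ?ltr_pdivlMr; lra.
- have := mid _ x0 x2.
  by case: (leP y 1) => y1; [have := top _ y2 y1|]; lra.
- case: (leP x 1) => x1; case: (leP y 1) => y1; try lra.
  + by rewrite ltrD2l ltrN2 ltf_pV2 ?posrE //; lra.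
  + by have := top _ x2 x1; lra.
Qed.

Lemma b_funK : cancel b_fun b_inv.
Proof.
move=> x; rewrite /b_fun.
have [x0|x0] := leP x 0; first by rewrite /b_inv x0.
have [x2|x2] := leP x 2^-1.
  have h : 0 < x / (1 - x) <= 1 by rewrite divr_gt0 ?ler_pdivrMr; lra.
  rewrite /b_inv leNgt; case/andP: h => -> -> /=.
  by field; apply/andP; split; apply/eqP; lra.
have [x1|x1] := leP x 1.
  have h : 1 < 3 - x^-1 <= 2.
    have : x^-1 * x = 1 by rewrite mulVf //; lra.
    have : 0 < x^-1 by rewrite invr_gt0; lra.
    by move=> ? ?; apply/andP; split; nra.
  rewrite /b_inv; do 3 (case: leP => ?; try lra).
  by rewrite opprB addrC subrK invrK.
by rewrite /b_inv; do 3 (case: leP => ?; try lra).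
Qed.

Lemma b_invK : cancel b_inv b_fun.
Proof.
move=> x; rewrite /b_inv.
have [x0|x0] := leP x 0; first by rewrite /b_fun x0.
have [x1|x1] := leP x 1.
  have h : 0 < x / (1 + x) <= 2^-1 by rewrite divr_gt0 ?ler_pdivrMr; lra.
  rewrite /b_fun leNgt; case/andP: h => -> -> /=.
  by field; apply/andP; split; apply/eqP; lra.
have [x2|x2] := leP x 2.
  have h : 2^-1 < (3 - x)^-1 <= 1.
    have : (3 - x)^-1 * (3 - x) = 1 by rewrite mulVf //; lra.
    have : 0 < (3 - x)^-1 by rewrite invr_gt0; lra.
    by move=> ? ?; apply/andP; split; nra.
  by rewrite /b_fun; do 3 (case: leP => ?; try lra).
by rewrite /b_fun; do 3 (case: leP => ?; try lra).
Qed.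

Lemma c_incr : {homo c_fun : x y / x < y}.
Proof.
have mid (x : R) : 0 <= x <= 1 -> 0 <= 2 * x / (1 + x) <= 1.
  by move=> x01; rewrite divr_ge0 ?ler_pdivrMr; lra.
move=> x y xy; rewrite /c_fun.
have [x01|x01] := boolP (0 <= x <= 1); have [y01|y01] := boolP (0 <= y <= 1).
- by rewrite ltr_pdivrMr 1?mulrAC ?ltr_pdivlMr; lra.
- by have := mid _ x01; lra.
- by have := mid _ y01; lra.
- by [].
Qed.

Lemma c_funK : cancel c_fun c_inv.
Proof.
move=> x; rewrite /c_fun.
have [x01|x01] := boolP (0 <= x <= 1); last by rewrite /c_inv (negbTE x01).
have h : 0 <= 2 * x / (1 + x) <= 1 by rewrite divr_ge0 ?ler_pdivrMr; lra.
by rewrite /c_inv h; field; apply/andP; split; apply/eqP; lra.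
Qed.

Lemma c_invK : cancel c_inv c_fun.
Proof.
move=> x; rewrite /c_inv.
have [x01|x01] := boolP (0 <= x <= 1); last by rewrite /c_fun (negbTE x01).
have h : 0 <= x / (2 - x) <= 1 by rewrite divr_ge0 ?ler_pdivrMr; lra.
by rewrite /c_fun h; field; apply/andP; split; apply/eqP; lra.
Qed.

Lemma d_incr : {homo d_fun : x y / x < y}.
Proof.
by move=> x y; rewrite /d_fun; case: (leP 0 x); case: (leP 0 y); lra.
Qed.

Lemma d_funK : cancel d_fun d_inv.
Proof.
by move=> x; rewrite /d_fun /d_inv; case: (leP 0 x) => ?; case: leP => ?; lra.
Qed.

Lemma d_invK : cancel d_inv d_fun.
Proof.
by move=> x; rewrite /d_fun /d_inv; case: (leP 0 x) => ?; case: leP => ?; lra.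
Qed.

Lemma e_incr : {homo e_fun : x y / x < y}.
Proof.
by move=> x y; rewrite /e_fun; case: (leP x 0); case: (leP y 0); lra.
Qed.

Lemma e_funK : cancel e_fun e_inv.
Proof.
by move=> x; rewrite /e_fun /e_inv; case: (leP x 0) => ?; case: leP => ?; lra.
Qed.

Lemma e_invK : cancel e_inv e_fun.
Proof.
by move=> x; rewrite /e_fun /e_inv; case: (leP x 0) => ?; case: leP => ?; lra.
Qed.

Definition map_a : homeo R := incr_homeo a_funK a_invK a_incr.
Definition map_b : homeo R := incr_homeo b_funK b_invK b_incr.
Definition map_c : homeo R := incr_homeo c_funK c_invK c_incr.
Definition map_d : homeo R := incr_homeo d_funK d_invK d_incr.
Definition map_e : homeo R := incr_homeo e_funK e_invK e_incr.

Definition LM_G0 : set (homeo R) := generated [set map_a; map_b; map_c].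
Definition LM_G : set (homeo R) := generated (LM_G0 `|` [set map_d; map_e]).

End LodhaMoore.

Arguments LM_G0 R : clear implicits.
Arguments LM_G R : clear implicits.

(* Main.v *)
Require Import Defs.
From mathcomp Require Import all_boot all_order all_algebra.
From mathcomp Require Import all_classical all_reals all_analysis.
From mathcomp Require Import complex finmap lra ring.
Import numFieldNormedType.Exports.
Import Order.TTheory GRing.Theory Num.Theory.
Set Implicit Arguments.
Unset Strict Implicit.
Unset Printing Implicit Defensive.

(** Each of the three groups L contains four homeomorphisms h_i, i < 4, which
    coincide on [0, 1] with projective maps [twist (x ^+ i.+2) x], where
    0 < x <= 1/8. The twists map [0, 1] into itself and are nearly the identity
    there, and in an alternating product of twists and inverses of twists with
    no adjacent equal indices the lower left entry does not vanish. Nothing is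
    asked of the h_i outside [0, 1], and they may satisfy many relations. This
    already gives |h_0 F `|` ... `|` h_3 F| >= 2 |F| for every finite set F of
    homeomorphisms of the line ([translates_doubling]); the marriage theorem
    for infinite families ([marriage]) then assigns to every g in L two
    elements among the h_i g so that no element is used twice, and this is a
    paradoxical decomposition with 4 + 4 pieces ([paradoxical_of_doubling]).

    Doubling is a cost argument. The points g^-1(0) and g^-1(1), for g in F,
    cut the line into cells, and each g maps a cell either into [0, 1] or away
    from ]0, 1[. Fix a cell C, give a homeomorphism f the weight
    w_C(f) = |f(C) `&` [0, 1]|, and join g to each h_i g when g maps C into
    [0, 1]. Around a cycle of this graph one reads an alternating product of
    twists and inverses that fixes every point of g(C); such a product is
    scalar, against the choice of x, so the graph is a forest
    ([acyclic_edges]). The twists multiply lengths by at least 3/4, so 3/4 w_C(g)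
    is at most the weight of both ends of the edge from g to h_i g. Removing
    leaves one by one shows that in a forest the edges weigh at most as much as
    the vertices ([forest_weight]). Hence 4 * 3/4 * sum_F w_C is at most the
    sum of w_C over F plus its sum over the h_i F. Summed over the cells, every
    element of F has total weight 1 and every other homeomorphism at most 1,
    and the inequality becomes 3 |F| <= |F| + |h_0 F `|` ... `|` h_3 F|.

    The lower left entry of an alternating product is P(x) for some P in Z[X]
    with leading coefficient 1 or -1 and no complex root of modulus >= 3
    ([dominated_step]). Let 0 < b < 1 and x = b^k with k large. If b is not an
    algebraic integer, P(X^k) cannot vanish at b. Otherwise the gcd of P(X^k)
    and of an equation of b is, up to a unit, an integer polynomial with nonzero
    constant term; but the modulus of this term is the product of the moduli of
    the roots, one of which is b while the others are at most 3^(1/k), which is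
    absurd ([integral_avoid]).

    It remains to find the h_i. In G_0, and hence in G, take b = 1/2: in the
    coordinate s = t / (1 - t) on [0, 1], the generator c is s |-> 2 s, while
    b^-1 and b^-1 a are s |-> s / (1 + s) and s |-> s + 1; conjugation by powers
    of c replaces 1 by 2^-k ([dyadic_twisting]). In H(A), take b in A; a twist M
    on [0, 1] is extended by t |-> t - 1 outside the interval bounded by the two
    fixed points of the hyperbolic map t |-> M(t) + 1, which contains [0, 1]
    ([glued_two_pieces]). *)

(** * The marriage theorem for infinite families *)

Section Marriage.
Variables V W : choiceType.
Local Open Scope fset_scope.
Implicit Types (N : V -> {fset W}) (F : {fset V}).

Definition nbhd N F : {fset W} := \bigcup_(v <- F) N v.

Lemma in_nbhd A F w : reflect (exists2 v, v \in F & w \in A v) (w \in nbhd A F).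
Proof.
apply: (iffP (bigfcupP _ _ _ _)) => -[v vF wA]; exists v => //.
  by move: vF; rewrite andbT.
by rewrite vF.
Qed.

Lemma nbhdU1 A v F : nbhd A (v |` F) = A v `|` nbhd A F.
Proof.
apply/fsetP => w; rewrite in_fsetU; apply/in_nbhd/orP => [[u]|[wv|/in_nbhd[u uF wu]]].
- rewrite in_fset1U => /orP[/eqP-> wv|uF wu]; first by left.
  by right; apply/in_nbhd; exists u.
- by exists v; rewrite ?fset1U1.
- by exists u; rewrite // in_fset1U uF orbT.
Qed.

Lemma eq_nbhd A B F : (forall v, v \in F -> A v = B v) -> nbhd A F = nbhd B F.
Proof.
by move=> AB; apply/fsetP => w; apply/in_nbhd/in_nbhd => -[v vF];
  [rewrite AB // => wv | rewrite -AB // => wv]; exists v.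
Qed.

Definition hall N : Prop := forall F, (#|` F| <= #|` nbhd N F|)%N.

(** Zorn's lemma applies because the sets are finite: along a chain of
    families, the members that a finite set [F] sees are eventually
    constant, so Hall's condition passes to the intersection. *)
Lemma hall_minimal N : hall N -> exists A, [/\ hall A, forall v, A v `<=` N v &
  forall B, hall B -> (forall v, B v `<=` A v) -> B = A].
Proof.
move=> hN.
pose T := {A | hall A /\ forall v, A v `<=` N v}.
pose R (A B : T) := `[< forall v, sval B v `<=` sval A v >].
have [//|||C Ctot|A Amin] := @Zorn T R.
- by move=> A; apply/asboolP => v.
- move=> A B D /asboolP AB /asboolP BD; apply/asboolP => v.
  exact: fsubset_trans (BD v) (AB v).
- move=> [A hA] [B hB] /asboolP AB /asboolP BA.
  suff E : A = B by subst B; congr exist; exact: Prop_irrelevance.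
  by apply/funext => v; apply/eqP; rewrite eqEfsubset BA AB.
- have [[A0 CA0]|C0] := pselect (exists A, C A); last first.
    exists (exist _ N (conj hN (fun v => fsubset_refl (N v)))) => A CA.
    by exfalso; apply: C0; exists A.
  (* along the chain, a smallest value at [v] is contained in all the others *)
  have minC v : exists A, C A /\ forall B, C B -> sval A v `<=` sval B v.
    have [n] := ubnP #|` sval A0 v|; elim: n A0 CA0 => // n IHn A CA /ltnSE An.
    have [hA|] := pselect (forall B, C B -> sval A v `<=` sval B v).
      by exists A.
    move=> /existsNP[B /not_implyP[CB /negP AB]].
    apply: (IHn B CB); apply: leq_trans An; apply: fproper_ltn_card.
    rewrite fproperE AB andbT.
    have [/asboolP ->//|/asboolP BA] := Ctot _ _ CA CB.
    by rewrite BA in AB.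
  pose b v := projT1 (cid (minC v)).
  have Cb v : C (b v) by have [] := projT2 (cid (minC v)).
  have bmin v B : C B -> sval (b v) v `<=` sval B v.
    by have [_] := projT2 (cid (minC v)); apply.
  pose B v := sval (b v) v.
  have common F : exists2 A, C A & forall v, v \in F -> sval A v = B v.
    elim/finSet_rect: F => F IH.
    have [->|/fset0Pn[v vF]] := eqVneq F fset0; first by exists A0.
    have [A CA AF] := IH _ (fproperD1 vF).
    have [/asboolP h|/asboolP h] := Ctot _ _ CA (Cb v).
      exists (b v) => // u uF; apply/eqP; rewrite eqEfsubset bmin ?andbT //.
      have [->//|uv] := eqVneq u v.
      by rewrite -AF // in_fsetD1 uv.
    exists A => // u uF; have [->|uv] := eqVneq u v.
      by apply/eqP; rewrite eqEfsubset h bmin.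
    by rewrite AF // in_fsetD1 uv.
  have hB : hall B.
    move=> F; have [A _ AF] := common F.
    by rewrite -(eq_nbhd AF); have [] := svalP A.
  have BN v : B v `<=` N v by have [_] := svalP (b v); apply.
  exists (exist _ B (conj hB BN)) => A CA; apply/asboolP => v /=; exact: bmin.
- exists (sval A); have [hA AN] := svalP A; split=> // B hB BA.
  have BN v : B v `<=` N v by apply: fsubset_trans (BA v) (AN v).
  suff /Amin/(congr1 sval) : R A (exist _ B (conj hB BN)) by [].
  exact/asboolP.
Qed.

(** Rado's argument. In a minimal family satisfying Hall's condition every
    set is a singleton: if [A v] contained [x <> y], the deletion of either
    would violate the condition at some sets [v |` F1] and [v |` F2], and
    the submodularity of cardinals would violate it at [v |` (F1 `|` F2)] or
    at [F1 `&` F2]. *)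
Theorem marriage N : hall N -> exists2 phi : V -> W, injective phi & forall v, phi v \in N v.
Proof.
move=> /hall_minimal[A [hA AN Amin]].
pose del v x u := if u == v then A v `\ x else A u.
have critical v x : x \in A v -> exists2 F, v \notin F & (#|` nbhd A F `|` (A v `\ x)| <= #|` F|)%N.
  move=> xv; have : ~ hall (del v x).
    move=> hd; have dA u : del v x u `<=` A u.
      by rewrite /del; case: eqP => [->|//]; exact: fsubD1set.
    have /(congr1 (fun f => x \in f v)) := Amin _ hd dA.
    by rewrite /del eqxx in_fsetD1 eqxx xv.
  move=> /existsNP[F /negP]; rewrite -ltnNge => hF.
  have vF : v \in F.
    apply: contraLR hF => vF; rewrite -leqNgt (@eq_nbhd _ A) // => u uF.
    by rewrite /del; case: eqP => // uv; rewrite -uv uF in vF.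
  exists (F `\ v); first by rewrite in_fsetD1 eqxx.
  have -> : nbhd A (F `\ v) `|` (A v `\ x) = nbhd (del v x) F.
    rewrite -[in RHS](fsetD1K vF) nbhdU1 fsetUC /del eqxx; congr (_ `|` _).
    by apply: eq_nbhd => u; rewrite in_fsetD1 => /andP[/negbTE->].
  by move: hF; rewrite (cardfsD1 v F) vF.
have sing v : exists w, A v = [fset w].
  have : (0 < #|` A v|)%N.
    by have := hA [fset v]; rewrite cardfs1 -[[fset v]]fsetU0 nbhdU1 /nbhd big_nil fsetU0.
  rewrite cardfs_gt0 => /fset0Pn[x xv]; exists x.
  apply/eqP; rewrite eqEfsubset fsub1set xv andbT; apply/fsubsetP => y yv.
  rewrite in_fset1; apply/negPn/negP => yx.
  have [F1 v1 h1] := critical _ _ xv; have [F2 v2 h2] := critical _ _ yv.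
  have hU : nbhd A (v |` (F1 `|` F2)) `<=`
      (nbhd A F1 `|` (A v `\ x)) `|` (nbhd A F2 `|` (A v `\ y)).
    apply/fsubsetP => w; rewrite nbhdU1 !in_fsetU !in_fsetD1.
    case/orP => [wv|/in_nbhd[u]]; last first.
      rewrite in_fsetU => /orP[] uF wu.
        by rewrite (_ : w \in nbhd A F1) //; apply/in_nbhd; exists u.
      by rewrite (_ : w \in nbhd A F2) ?orbT //; apply/in_nbhd; exists u.
    rewrite wv !andbT; case: (eqVneq w x) => [->|_] /=; last by rewrite orbT.
    by rewrite eq_sym yx !orbT.
  have hI : nbhd A (F1 `&` F2) `<=`
      (nbhd A F1 `|` (A v `\ x)) `&` (nbhd A F2 `|` (A v `\ y)).
    apply/fsubsetP => w /in_nbhd[u]; rewrite !inE => /andP[u1 u2] wu.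
    by apply/andP; split; apply/orP; left; apply/in_nbhd; exists u.
  have := leq_trans (leq_add (hA (v |` (F1 `|` F2))) (hA (F1 `&` F2)))
                    (leq_add (fsubset_leq_card hU) (fsubset_leq_card hI)).
  rewrite !cardfsUI cardfsU1 in_fsetU (negbTE v1) (negbTE v2) -addnA cardfsUI add1n.
  by move=> /leq_trans/(_ (leq_add h1 h2)); rewrite ltnn.
pose phi v := projT1 (cid (sing v)).
have phiE v : A v = [fset phi v] by rewrite /phi; case: cid.
exists phi => [v w vw|v]; last by apply: (fsubsetP (AN v)); rewrite phiE in_fset1.
apply/eqP/negPn/negP => nvw; have := hA [fset v; w].
rewrite cardfs2 nvw -[[fset v; w]]/(v |` [fset w]) nbhdU1.
rewrite -[[fset w]]fsetU0 nbhdU1 /nbhd big_nil fsetU0 !phiE vw fsetUid.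
by rewrite cardfs1.
Qed.
End Marriage.

Local Open Scope classical_set_scope.

(** * Paradoxical decompositions from doubling *)

Section Paradox.
Variables (G : groupType) (n : nat) (s : 'I_n.+1 -> G).
Local Open Scope fset_scope.

Definition translates (F : {fset G}) : {fset G} :=
  \bigcup_(i <- enum 'I_n.+1) [fset (s i * g)%g | g in F].

Lemma translatesP F x :
  reflect (exists2 g, g \in F & exists i, x = (s i * g)%g) (x \in translates F).
Proof.
apply: (iffP (bigfcupP _ _ _ _)) => [[i _ /imfsetP[g /= gF ->]]|[g gF [i ->]]].
  by exists g => //; exists i.
by exists i; rewrite ?mem_enum //; apply/imfsetP; exists g.
Qed.

(** The marriage theorem is applied to [L] taken twice. An element [phi (g,
    b)] of the form [s i * g] is put into the [i]-th piece of the [b]-th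
    kind, and is sent back to [g] by the inverse of [s i]. *)
Lemma paradoxical_of_doubling (L : set G) : L 1%g ->
  (forall i g, L g -> L (s i * g)%g) -> (forall i g, L g -> L ((s i)^-1 * g)%g) ->
  (forall F : {fset G}, (2 * #|` F| <= #|` translates F|)%N) ->
  paradoxical L n.+1 n.+1.
Proof.
move=> L1 sL VL dbl.
pose N (v : G * bool) := translates [fset v.1].
have [phi phiI phiN] : exists2 phi : G * bool -> G, injective phi &
    forall v, phi v \in N v.
  apply: marriage => F; pose F1 := [fset v.1 | v in F].
  have /fsubset_leq_card h : F `<=`
      [fset (g, true) | g in F1] `|` [fset (g, false) | g in F1].
    apply/fsubsetP => -[g b] gbF; have gF1 : g \in F1 by apply/imfsetP; exists (g, b).
    by rewrite in_fsetU; apply/orP; case: b {gbF}; [left|right];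
      apply/imfsetP; exists g.
  apply: leq_trans h (leq_trans (leq_card_fsetU _ _) _).
  apply: leq_trans (leq_trans (leq_add (leq_imfset_card _ _ _) (leq_imfset_card _ _ _)) _)
    (_ : (2 * #|` F1| <= _)%N).
    by rewrite mul2n -addnn.
  apply: leq_trans (dbl F1) _; apply: fsubset_leq_card.
  apply/fsubsetP => x /translatesP[g /imfsetP[v /= vF ->] [i ->]].
  apply/in_nbhd; exists v => //; apply/translatesP; exists v.1; rewrite ?inE //.
  by exists i.
have idx v : exists i, phi v = (s i * v.1)%g.
  by have /translatesP[g] := phiN v; rewrite inE => /eqP-> [i ->]; exists i.
pose c v := projT1 (cid (idx v)).
have phiE v : phi v = (s (c v) * v.1)%g by rewrite /c; case: cid.
pose P b i := [set x | exists g, [/\ L g, c (g, b) = i & x = phi (g, b)]]%classic.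
pose rest (i : 'I_n.+1) :=
  [set x | [/\ i = ord0, L x & forall g b, L g -> x <> phi (g, b)]]%classic.
have PL b i x : P b i x -> L x.
  by case=> g [Lg _ ->]; rewrite phiE; exact: sL.
have trivP b i j x : P b i x -> P b j x -> i = j.
  by move=> [g [_ <- ->]] [h [_ <-]] /phiI[->].
have restP i j b x : P b i x -> ~ rest j x.
  by move=> [g [Lg _ ->]] [_ _ /(_ g b Lg)].
(* elements that are not values of [phi] go to the first piece *)
exists (fun i => P false i `|` rest i)%classic, (P true), (fun i => (s i)^-1)%g,
  (fun i => (s i)^-1)%g.
have sV i : L (s i)^-1%g by rewrite -[(s i)^-1%g]mulg1; exact: VL.
have surj b g : L g -> exists i, exists2 x, P b i x & ((s i)^-1 * x)%g = g.
  move=> Lg; exists (c (g, b)), (phi (g, b)); first by exists g.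
  by rewrite phiE mulKg.
split; split => //.
- move=> i j _ _ [x [[Pi|ri] [Pj|rj]]].
  + exact: trivP Pi Pj.
  + by case: (restP _ _ _ _ Pi rj).
  + by case: (restP _ _ _ _ Pj ri).
  + by case: ri rj => [-> _ _] [->].
- by move=> i j _ _ [x [Pi Pj]]; exact: trivP Pi Pj.
- move=> i j; apply/seteqP; split=> // x [[[g [_ _ ->]]|ri] Pj].
    by case: Pj => h [_ _ /phiI].
  by case: (restP _ _ _ _ Pj ri).
- apply/seteqP; split=> [x [[i _ [/PL//|[_ //]]]|[i _ /PL//]]|x Lx].
  have [[g [b [Lg xE]]]|nx] := pselect (exists g b, L g /\ x = phi (g, b)).
    have Px : P b (c (g, b)) x by exists g.
    by case: b Px {xE} => Px; [right|left; exists (c (g, false)) => //; left];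
      first exists (c (g, true)).
  left; exists ord0 => //; right; split=> // g b Lg xE; apply: nx.
  by exists g, b.
- apply/seteqP; split=> [_ [i _ [x Px <-]]|g Lg].
    by apply: VL; case: Px => [/PL//|[]].
  by have [i [x Px xg]] := surj false g Lg; exists i => //; exists x => //; left.
- apply/seteqP; split=> [_ [i _ [x Px <-]]|g Lg].
    by apply: VL; exact: PL Px.
  by have [i [x Px xg]] := surj true g Lg; exists i => //; exists x.
Qed.
End Paradox.

Lemma paradoxical_tarski (G : groupType) (L : set G) n m :
  paradoxical L n m -> exists2 k, is_tarski_number L k & (k <= n + m)%N.
Proof.
move=> Lnm; pose P k := `[< exists n m, paradoxical L n m /\ k = (n + m)%N >].
have Pnm a b : paradoxical L a b -> P (a + b)%N by move=> h; apply/asboolP; exists a, b.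
have exP : exists k, P k by exists (n + m)%N; exact: Pnm.
have [k /asboolP Pk kmin] := ex_minnP exP; exists k; last exact/kmin/Pnm.
by split=> // a b /Pnm; exact: kmin.
Qed.

Local Open Scope ring_scope.

(** * Weighted forests *)

Section Forest.
Variables (K : realDomainType) (X U W : choiceType) (l : X -> U) (r : X -> W).
Local Open Scope fset_scope.
Local Open Scope ring_scope.
Implicit Types (E : {fset X}) (x : X).

(** The elements of [X] are the edges of a bipartite graph with ends given
    by [l] and [r]; such an edge is a leaf of [E] when one of its ends is on
    no other edge of [E]. *)
Definition leaf E x : Prop :=
  (forall z, z \in E -> l z = l x -> z = x) \/
  (forall z, z \in E -> r z = r x -> z = x).

Definition forest E : Prop :=
  forall E', E' `<=` E -> E' != fset0 -> exists2 x, x \in E' & leaf E' x.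

Lemma big_fset_le (T : choiceType) (A B : {fset T}) (f : T -> K) :
  (forall t, 0 <= f t) -> A `<=` B -> \sum_(t <- A) f t <= \sum_(t <- B) f t.
Proof.
move=> f0 AB; rewrite [leRHS](big_fsetID _ (mem A)) /=.
have -> : [fset t in B | t \in A] = A.
  apply/fsetP => t; rewrite !inE /= andbC; case: (boolP (t \in A)) => //= tA.
  by rewrite (fsubsetP AB).
by rewrite lerDl sumr_ge0.
Qed.

(** A leaf weighs at most as much as its free end; after the leaf is
    deleted, this end is no longer an end of any edge. *)
Lemma forest_weight E (a : U -> K) (b : W -> K) (c : X -> K) :
  (forall u, 0 <= a u) -> (forall w, 0 <= b w) ->
  (forall x, x \in E -> c x <= a (l x)) -> (forall x, x \in E -> c x <= b (r x)) ->
  forest E ->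
  \sum_(x <- E) c x <= \sum_(u <- l @` E) a u + \sum_(w <- r @` E) b w.
Proof.
move=> a0 b0 + + ; have [n] := ubnP #|` E|; elim: n E => // n IHn E /ltnSE sE ca cb fE.
have [->|E0] := eqVneq E fset0.
  by rewrite big_seq_fset0 addr_ge0 ?sumr_ge0.
have [x xE lx] := fE E (fsubset_refl E) E0.
have E'E : E `\ x `<=` E by exact: fsubD1set.
have IH : \sum_(z <- E `\ x) c z <=
    \sum_(u <- l @` (E `\ x)) a u + \sum_(w <- r @` (E `\ x)) b w.
  apply: IHn => [||z /(fsubsetP E'E)/cb //|E'' E''E].
  - by apply: leq_trans sE; apply/fproper_ltn_card/fproperD1.
  - by move=> z /(fsubsetP E'E)/ca.
  - by apply: fE; apply: fsubset_trans E''E E'E.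
rewrite (big_fsetD1 x) //=.
have mono (T : choiceType) (f : X -> T) : f @` (E `\ x) `<=` f @` E.
  by apply: subset_imfset => z; exact: (fsubsetP E'E).
have split (T : choiceType) (f : X -> T) (d : T -> K) :
    (forall z, z \in E -> f z = f x -> z = x) ->
    \sum_(t <- f @` E) d t = d (f x) + \sum_(t <- f @` (E `\ x)) d t.
  have fE' : f @` E = f x |` f @` (E `\ x) by rewrite -imfsetU1 fsetD1K.
  move=> inj; rewrite fE' big_fsetU1 //=.
  apply/imfsetP => -[z]; rewrite /= in_fsetD1 => /andP[/eqP zx zE] /esym fzx.
  exact/zx/inj.
case: lx => inj; rewrite (split _ _ _ inj).
- rewrite -addrA; apply: lerD (ca _ xE) (le_trans IH _).
  by rewrite lerD2l big_fset_le.
- rewrite addrCA; apply: lerD (cb _ xE) (le_trans IH _).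
  by rewrite lerD2r big_fset_le.
Qed.

End Forest.
Lemma iter_cycle (T : choiceType) (E : {fset T}) (f : T -> T) : E != fset0 ->
  (forall x, x \in E -> f x \in E) ->
  exists2 x, x \in E & exists n, iter n.+1 f x = x.
Proof.
case/fset0Pn => x0 x0E fE.
have itE k : iter k f x0 \in E by elim: k => //= k; exact: fE.
pose h (k : 'I_(#|`E|.+1)) : E := FSetSub (itE k).
have /injectivePn[i [j ij /(congr1 val)/= hij]] : ~~ injectiveb h.
  apply/negP => /injectiveP/leq_card; rewrite card_ord -cardfE ltnn //.
wlog lij : i j ij hij / (i < j)%N.
  move=> w; case: (ltngtP i j) => h'; [exact: (w i j ij hij h')| |].
    by apply: (w j i _ (esym hij) h'); rewrite eq_sym.
  by move: ij; rewrite (val_inj h') eqxx.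
exists (iter i f x0) => //; exists (j - i).-1.
by rewrite -iterS prednK ?subn_gt0 // -iterD subnK // ltnW.
Qed.

(** * Powers that are not roots of given integer polynomials *)

Definition exterior_unital (R : rcfType) (P : {poly int}) : Prop :=
  `|lead_coef P| = 1 /\
  forall z : R[i]%C, 3 <= `|z| -> (map_poly intr P).[z] != 0.

Definition avoids (R : rcfType) (x : R) : Prop :=
  forall P, exterior_unital R P -> (map_poly intr P).[x] != 0.

Lemma comp_Xn_exterior (R : rcfType) (P : {poly int}) k : (0 < k)%N ->
  exterior_unital R P ->
  `|lead_coef (P \Po 'X^k)| = 1 /\
  forall z : R[i]%C, (map_poly intr (P \Po 'X^k)).[z] = 0 -> `|z ^+ k| < 3.
Proof.
move=> k0 [P1 Pz]; split.
  by rewrite lead_coef_comp ?size_polyXn // lead_coefXn expr1n mulr1.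
move=> z; rewrite map_comp_poly map_polyXn horner_comp hornerXn => zk.
rewrite real_ltNge ?normr_real ?realn //.
by apply/negP => /Pz; rewrite zk eqxx.
Qed.

(** Powers of ['X] are divided out of [m]. *)
Lemma monic_root_nz0 (R : idomainType) (m : {poly int}) (b : R) :
  m \is monic -> b != 0 -> root (map_poly intr m) b ->
  exists m' : {poly int}, [/\ m' \is monic, root (map_poly intr m') b & m'`_0 != 0].
Proof.
move=> mm b0; have [n] := ubnP (size m).
elim: n m mm => // n IHn m mm /ltnSE sm rm.
have [m0|m0] := eqVneq m`_0 0; last by exists m.
have /factor_theorem[q qE] : root m 0 by rewrite /root horner_coef0 m0.
rewrite subr0 in qE.
have mq : q \is monic by move: mm; rewrite qE monicMr ?monicX.
have q0 : q != 0 by exact: monic_neq0.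
apply: (IHn q mq).
  by move: sm; rewrite qE size_mulX.
by move: rm; rewrite qE rmorphM /= map_polyX rootM rootX (negbTE b0) orbF.
Qed.

Section Avoid.
Variable R : rcfType.

(** If [P] vanishes at [b ^+ k], then [b] is a root of the gcd of [m] and [P
    \Po 'X^k], which by Gauss's lemma is an integer polynomial [p] up to a
    scalar. The constant term of [p] divides that of [m], so it is a nonzero
    integer; but up to sign it is the product of the complex roots of [p],
    all of modulus at most [3 ^ (1 / k)] and one of them equal to [b]. *)
Lemma integral_avoid (b : R) (m : {poly int}) k : (0 < k)%N -> 0 < b ->
  m \is monic -> root (map_poly intr m) b -> m`_0 != 0 ->
  b ^+ k * 3 ^+ size m < 1 ->
  avoids (b ^+ k).
Proof.
move=> k0 b0 mm rm m0 small P gP; apply/negP => /eqP Pb.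
have [Q1 Qz] := comp_Xn_exterior k0 gP.
set Q := P \Po 'X^k in Q1 Qz.
have Qb : root (map_poly intr Q) b.
  by rewrite /root map_comp_poly map_polyXn horner_comp hornerXn Pb.
pose D := gcdp (map_poly (intr : int -> rat) m) (map_poly intr Q).
have /dvdpP_rat_int[p [a a0 DE] [r mE]] : D %| map_poly intr m.
  exact: dvdp_gcdl.
have ratintr (F : numFieldType) (q : {poly int}) :
    map_poly (ratr : rat -> F) (map_poly intr q) = map_poly intr q.
  by rewrite -map_poly_comp; apply: eq_map_poly => z /=; rewrite ratr_int.
have pD (F : numFieldType) (z : F) : root (map_poly intr p) z =
    root (map_poly intr m) z && root (map_poly intr Q) z.
  rewrite -[map_poly intr p]ratintr.
  rewrite -(@rootZ _ _ (ratr a)) ?fmorph_eq0 // -map_polyZ -DE gcdp_map.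
  by rewrite root_gcd !ratintr.
have pb : root (map_poly intr p) b by rewrite pD rm Qb.
have lp1 : `|lead_coef p| = 1.
  have : lead_coef p * lead_coef r = 1 by rewrite -lead_coefM -mE (monicP mm).
  move/(congr1 (fun z : int => absz z)); rewrite abszM => /eqP.
  by rewrite muln_eq1 => /andP[/eqP h _]; rewrite -abszE h.
have p0 : p`_0 != 0.
  by apply: contraNneq m0 => p0; rewrite mE -horner_coef0 hornerM !horner_coef0 p0 mul0r.
have pn0 : p != 0 by apply: contraNneq p0 => ->; rewrite coef0.
have rn0 : r != 0.
  by apply: contraTneq mm => r0; rewrite mE r0 mulr0 monicE lead_coef0.
pose pC : {poly R[i]%C} := map_poly intr p.
have [s sE] := closed_field_poly_normal pC.
have lC : `|lead_coef pC| = 1.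
  rewrite lead_coef_map_inj //; last exact: intr_inj.
  by rewrite -intr_norm lp1.
have pC0 : pC != 0 by rewrite -lead_coef_eq0 -normr_eq0 lC oner_eq0.
have sp z : root pC z = (z \in s).
  by rewrite sE rootZ ?root_prod_XsubC // lead_coef_eq0.
have bs : b%:C%C \in s.
  rewrite -sp /pC -[map_poly _ _](_ : map_poly (real_complex R) (map_poly intr p) = _).
    by rewrite fmorph_root.
  by rewrite -map_poly_comp; apply: eq_map_poly => z /=; rewrite rmorph_int.
have sz z : z \in s -> `|z| ^+ k <= 3.
  rewrite -sp pD => /andP[_ /eqP/Qz]; rewrite normrX; exact: ltW.
have ss : (size s <= size m)%N.
  have -> : size m = (size p + size r).-1 by rewrite mE size_mul.
  have -> : size p = size pC by rewrite size_map_inj_poly //; exact: intr_inj.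
  rewrite sE size_scale ?lead_coef_eq0 // size_prod_XsubC.
  by rewrite addSn /= leq_addr.
(* the root [b] contributes [b ^+ k], each other root at most 3 *)
have : `|pC.[0]| ^+ k < 1.
  rewrite sE hornerZ normrM lC mul1r horner_prod normr_prod.
  rewrite (perm_big _ (perm_to_rem bs)) big_cons !hornerXsubC sub0r normrN exprMn.
  have -> : \prod_(z <- rem b%:C%C s) `|('X - z%:P).[0]| = \prod_(z <- rem b%:C%C s) `|z|.
    by apply: eq_bigr => z _; rewrite hornerXsubC sub0r normrN.
  have nb : `|b%:C%C| = b%:C%C by rewrite ger0_norm // lecR ltW.
  rewrite nb -rmorphXn.
  have : b%:C%C ^+ k * 3 ^+ size m < 1.
    by have := small; rewrite -ltcR rmorph1 rmorphM !rmorphXn rmorph_nat.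
  rewrite -rmorphXn; apply: le_lt_trans; apply: ler_wpM2l.
    by rewrite lecR exprn_ge0 // ltW.
  rewrite -prodrXl; apply: le_trans (_ : 3 ^+ size s <= _); last first.
    by rewrite ler_weXn2l // ler1n.
  apply: le_trans (_ : 3 ^+ size (rem b%:C%C s) <= _).
    elim: (rem _ _) (fun z => @mem_rem _ b%:C%C s z) => [|z t IHt] h.
      by rewrite big_nil expr0.
    rewrite big_cons exprS ler_pM ?exprn_ge0 ?prodr_ge0 //.
    - by rewrite sz // h // mem_head.
    - by apply: IHt => w wt; rewrite h // inE wt orbT.
  by rewrite ler_weXn2l ?ler1n // size_rem // leq_pred.
apply/negP; rewrite -real_leNgt ?realX ?normr_real ?real1 //.
apply: exprn_ege1; rewrite horner_coef0 coef_map /= -intr_norm.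
by rewrite ler1z -gtz0_ge1 normr_gt0.
Qed.

End Avoid.

Lemma exprn_small (R : realType) (b e : R) :
  0 < b < 1 -> 0 < e -> exists2 k, (0 < k)%N & b ^+ k <= e.
Proof.
move=> /andP[b0 b1] e0.
have /cvgr0_norm_lt/(_ _ e0)[n _ hn] : (b ^+ k @[k --> \oo] --> (0 : R))%classic.
  by apply: cvg_expr; rewrite gtr0_norm.
exists n.+1 => //; have := hn n.+1 (leqnSn n).
by rewrite gtr0_norm ?exprn_gt0 // => /ltW.
Qed.

(** If [b] is not an algebraic integer, any [k] with [b ^+ k <= 8^-1] will
    do, since [P \Po 'X^k] is monic up to sign. *)
Lemma small_power_avoiding_roots (R : realType) (b : R) : 0 < b < 1 ->
  exists2 k, 0 < b ^+ k <= 8^-1 & avoids (b ^+ k).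
Proof.
move=> b01; have b0 : 0 < b by case/andP: b01.
have [[m0 [mm0 rm0]]|nint] :=
    pselect (exists m : {poly int}, m \is monic /\ root (map_poly intr m) b).
  have [m [mm rm m00]] := monic_root_nz0 mm0 (lt0r_neq0 b0) rm0.
  have e0 : 0 < 8^-1 * 3 ^- size m :> R by rewrite mulr_gt0 ?invr_gt0 ?exprn_gt0.
  have [k k0 bk] := exprn_small b01 e0.
  have bk8 : b ^+ k * 3 ^+ size m <= 8^-1.
    by rewrite -ler_pdivlMr ?exprn_gt0.
  exists k.
    rewrite exprn_gt0 //=; apply: le_trans bk8; rewrite ler_peMr ?exprn_ege1 ?ler1n //.
    by rewrite exprn_ge0 // ltW.
  apply: (integral_avoid k0 b0 mm rm m00); lra.
have e0 : 0 < 8^-1 :> R by lra.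
have [k k0 bk] := exprn_small b01 e0.
exists k; first by rewrite exprn_gt0.
move=> P gP; apply/negP => /eqP Pb; apply: nint.
have [Q1 _] := comp_Xn_exterior k0 gP.
set Q := P \Po 'X^k in Q1.
have Qb : root (map_poly intr Q) b.
  by rewrite /root map_comp_poly map_polyXn horner_comp hornerXn Pb.
exists (lead_coef Q *: Q); split.
  rewrite monicE lead_coefZ -expr2 -[_ ^+ 2]ger0_norm ?sqr_ge0 // normrX Q1.
  by rewrite expr1n.
by rewrite map_polyZ rootZ // intr_eq0 -normr_eq0 Q1.
Qed.

(** * Integer polynomials attached to reduced words *)

Section Pairs.
Variable R : rcfType.
Local Notation C := R[i]%C.

Lemma norm_expand (a b d e : C) : `|a| < `|b| -> 3 <= `|d| -> 3 <= `|e| ->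
  `|a + d * b| < `|b + e * (a + d * b)|.
Proof.
have nE (w : C) : `|w| = (complex.Re `|w|)%:C%C by rewrite normc_def.
have three : (3 : C) = 3%:C%C by rewrite rmorph_nat.
move=> ab d3 e3; set s := a + d * b.
have h1 : `|d| * `|b| <= `|s| + `|a|.
  by have := ler_normB s a; rewrite /s addrAC subrr add0r normrM.
have h2 : `|e| * `|s| <= `|b + e * s| + `|b|.
  by have := ler_normB (b + e * s) b; rewrite addrAC subrr add0r normrM.
have h3 : 0 <= `|a| by []. have h4 : 0 <= `|s| by [].
move: ab d3 e3 h1 h2 h3 h4.
have [[A AE] [B BE]] : (exists A, `|a| = A%:C%C) /\ (exists B, `|b| = B%:C%C).
  by split; eexists; exact: nE.
have [[D DE] [E EE]] : (exists D, `|d| = D%:C%C) /\ (exists E, `|e| = E%:C%C).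
  by split; eexists; exact: nE.
have [[S SE] [T TE]] : (exists S, `|s| = S%:C%C) /\
    (exists T, `|b + e * s| = T%:C%C) by split; eexists; exact: nE.
rewrite AE BE DE EE SE TE three.
rewrite -[0](rmorph0 (real_complex R)) -!rmorphM -!rmorphD !lecR !ltcR.
by move=> *; nra.
Qed.

(** An invariant of the first column [(P, Q)] of a product of shears, which
    grows both in degree and in modulus on [3 <= |z|]; in particular [Q]
    does not vanish there. *)
Definition dominated (P Q : {poly int}) : Prop :=
  [/\ `|lead_coef Q| = 1, (size P < size Q)%N &
      forall z : C, 3 <= `|z| -> `|(map_poly intr P).[z]| < `|(map_poly intr Q).[z]|].

(** The size bound makes [D * Q] dominate [P], and the bound by [3] makes a
    lower triangular factor with entry [z], [3 <= |z|], expand after an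
    upper triangular one with entry [D]. *)
Definition steep (D : {poly int}) : Prop :=
  [/\ `|lead_coef D| = 1, (1 < size D)%N &
      forall z : C, 3 <= `|z| -> 3 <= `|(map_poly intr D).[z]|].

Lemma dominated_exterior P Q : dominated P Q -> exterior_unital R Q.
Proof.
move=> [Q1 _ PQ]; split=> // z /PQ h.
by rewrite -normr_gt0; apply: le_lt_trans h.
Qed.

Lemma dominated_step P Q D (e : int) : dominated P Q -> steep D -> `|e| = 1 ->
  dominated (P + D * Q) (Q + (e *: 'X) * (P + D * Q)).
Proof.
move=> [Q1 PQ hz] [D1 Ds Dz] e1.
have nz (S : {poly int}) : `|lead_coef S| = 1 -> S != 0.
  by move=> S1; rewrite -lead_coef_eq0 -normr_eq0 S1.
have Q0 := nz _ Q1; have D0 := nz _ D1.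
have sQ : (0 < size Q)%N by rewrite size_poly_gt0.
have sDQ : (size P < size (D * Q)%R)%N.
  rewrite size_mul //; apply: leq_trans PQ _; move: Ds sQ; case: (size D) => [|n] //= n1 _.
  by rewrite leq_addl.
have lS : lead_coef (P + D * Q) = lead_coef D * lead_coef Q.
  by rewrite lead_coefDr // lead_coefM.
have sS : size (P + D * Q) = (size D + size Q).-1 by rewrite addrC size_polyDl // size_mul.
set S := P + D * Q in lS sS *.
have lS1 : `|lead_coef S| = 1 by rewrite lS normrM D1 Q1.
have e0 : e != 0 by rewrite -normr_eq0 e1.
have XSE : (e *: 'X) * S = e *: (S * 'X) by rewrite -scalerAl mulrC.
have sXS : size ((e *: 'X) * S) = (size D + size Q)%N.
  by rewrite XSE size_scale // size_mulX ?nz // sS prednK // addn_gt0 sQ orbT.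
have sQX : (size Q < size ((e *: 'X) * S)%R)%N.
  by rewrite sXS -{1}[size Q]add0n ltn_add2r (ltn_trans _ Ds).
split.
- by rewrite lead_coefDr // XSE lead_coefZ lead_coefMX normrM e1 lS1.
- have -> : size (Q + e *: 'X * S) = (size D + size Q)%N.
    by rewrite (addrC Q) size_polyDl.
  by rewrite -/S sS prednK // addn_gt0 sQ orbT.
- move=> z z3; rewrite !(rmorphD, rmorphM) /= map_polyZ map_polyX !hornerE.
  apply: norm_expand (hz _ z3) (Dz _ z3) _.
  by rewrite normrM -intr_norm e1 mul1r.
Qed.

Lemma dominated_start (e : int) : `|e| = 1 -> dominated 1 (e *: 'X).
Proof.
move=> e1; have e0 : e != 0 by rewrite -normr_eq0 e1.
split.
- by rewrite lead_coefZ lead_coefX mulr1.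
- by rewrite size_poly1 size_scale // size_polyX.
- move=> z z3; rewrite rmorph1 map_polyZ map_polyX !hornerE normr1 normrM.
  rewrite -intr_norm e1 mul1r; apply: lt_le_trans z3.
  by rewrite -[1]/(1%:R) ltr_nat.
Qed.

Lemma steepXn j : (0 < j)%N -> steep 'X^j.
Proof.
move=> j0; split.
- by rewrite lead_coefXn.
- by rewrite size_polyXn.
- move=> z z3; rewrite map_polyXn hornerXn normrX.
  have z1 : 1 <= `|z| by rewrite (le_trans _ z3) // ler1n.
  by rewrite -(prednK j0) exprS (le_trans z3) // ler_peMr // exprn_ege1.
Qed.

Lemma steepN D : steep D -> steep (- D).
Proof.
by case=> D1 Ds Dz; split; rewrite ?lead_coefN ?normrN ?size_polyN // => z z3;
  rewrite rmorphN hornerN normrN Dz.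
Qed.

(** [z ^ j - z ^ i] is the product of [z ^ i] and [z ^ (j - i) - 1], of
    moduli at least [3] and [2]. *)
Lemma steepB j i : (0 < i)%N -> (0 < j)%N -> i != j -> steep ('X^j - 'X^i).
Proof.
wlog ij : i j / (i < j)%N.
  move=> h i0 j0 ij; case: (ltngtP i j) ij => // ij _.
    by apply: h => //; rewrite ltn_eqF.
  rewrite -opprB; apply: steepN; apply: h => //; by rewrite ltn_eqF.
move=> i0 j0 _.
have sij : (size ('X^i : {poly int})%R < size ('X^j : {poly int})%R)%N.
  by rewrite !size_polyXn.
split.
- by rewrite lead_coefDl ?size_polyN // lead_coefXn.
- by rewrite size_polyDl ?size_polyN // size_polyXn.
move=> z z3; rewrite rmorphB /= !map_polyXn !hornerE.
have z1 : 1 <= `|z| by rewrite (le_trans _ z3) // ler1n.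
have -> : z ^+ j - z ^+ i = z ^+ i * (z ^+ (j - i) - 1).
  by rewrite mulrBr mulr1 -exprD subnKC // ltnW.
rewrite normrM -[3]mulr1; apply: ler_pM => //.
  by case: (steepXn i0) => _ _ /(_ z z3); rewrite map_polyXn hornerXn.
have ji0 : (0 < j - i)%N by rewrite subn_gt0.
have : 3 <= `|z ^+ (j - i)|.
  by case: (steepXn ji0) => _ _ /(_ z z3); rewrite map_polyXn hornerXn.
have := ler_normB (z ^+ (j - i)  - 1) (-1).
rewrite opprK subrK normrN1 => h /le_trans/(_ h).
by rewrite -lerBlDr; apply: le_trans; rewrite lerBrDr -[1]/(1%:R) -natrD ler_nat.
Qed.
End Pairs.

(** * Projective twists of the unit interval *)

Section Twist.
Variable R : realType.
Implicit Types (v : R * R) (x y t : R).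

Definition ushear y v : R * R := (v.1 + y * v.2, v.2).
Definition lshear x v : R * R := (v.1, v.2 + x * v.1).
(** The upper factors on both sides ensure that in a product of matrices of
    different [y] and their inverses, neighbouring upper factors merge into
    [ushear (y - y')] and never cancel. *)
Definition twist_vec y x v := ushear y (lshear x (ushear y v)).

(** The coordinate [v1 / (v1 + v2)] puts the cone of nonnegative vectors,
    which is preserved by the shears with nonnegative entries, in bijection
    with [0, 1]; a point [t] is represented by the vector [(t, 1 - t)]. *)
Definition chart v : R := v.1 / (v.1 + v.2).
Definition twist y x t : R := chart (twist_vec y x (t, 1 - t)).

Definition twist_den y x t : R :=
  (twist_vec y x (t, 1 - t)).1 + (twist_vec y x (t, 1 - t)).2.

Section Bounds.
Variables x y : R.
Definition small_twist := [/\ 0 < x, x <= 8^-1, 0 < y & y <= x / 8].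

Lemma twist_den_bounds t : small_twist -> 0 <= t <= 1 -> 1 <= twist_den y x t <= 8 / 7.
Proof.
move=> [x0 x8 y0 y8] /andP[t0 t1]; rewrite /twist_den /twist_vec /ushear /lshear /=.
have xy : 0 < x * y <= x / 8.
  have y64 : y <= 8^-1 by lra.
  by rewrite mulr_gt0 //= ler_pM2l.
have xyy : 0 < x * y * y <= x / 64.
  have y64 : y <= 8^-1 by lra.
  rewrite mulr_gt0 ?mulr_gt0 //=; case/andP: xy => xy0 xy8.
  by have := ler_pM (ltW xy0) (ltW y0) xy8 y64; lra.
have -> : t + y * (1 - t) + y * (1 - t + x * (t + y * (1 - t))) +
   (1 - t + x * (t + y * (1 - t))) = 1 + x * t + (2 * y + x * y) * (1 - t)
     + x * y * t + x * y * y * (1 - t) by ring.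
case/andP: xy => xy0 xy8; case/andP: xyy => xyy0 xyy8.
have yt : 0 <= (2 * y + x * y) * (1 - t) <= (x / 2) * (1 - t) by nra.
have xt : 0 <= x * t <= 8^-1 * t by nra.
have xyt : 0 <= x * y * t <= x / 64 by nra.
have xyyt : 0 <= x * y * y * (1 - t) <= x / 64 by nra.
by apply/andP; split; nra.
Qed.

Lemma twist_itv t : small_twist -> 0 <= t <= 1 -> 0 <= twist y x t <= 1.
Proof.
move=> st t01; have /andP[D1 _] := twist_den_bounds st t01.
have [x0 _ y0 _] := st.
have D0 : 0 < twist_den y x t by lra.
have /andP[h1 h2] : 0 <= (twist_vec y x (t, 1 - t)).1 <= twist_den y x t.
  move: t01 => /andP[t0 t1]; rewrite /twist_den /twist_vec /ushear /lshear /=.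
  have xy : 0 < x * y by rewrite mulr_gt0.
  have xyy : 0 < x * y * y by rewrite mulr_gt0.
  by apply/andP; split; nra.
by rewrite /twist /chart divr_ge0 //= ?ler_pdivrMr ?mul1r // ltW.
Qed.

(** The matrix has determinant 1. *)
Lemma twist_sub s t : small_twist -> 0 <= s <= 1 -> 0 <= t <= 1 ->
  twist y x t - twist y x s = (t - s) / (twist_den y x t * twist_den y x s).
Proof.
move=> st /(twist_den_bounds st)/andP[s1 _] /(twist_den_bounds st)/andP[t1 _].
have s0 : twist_den y x s != 0 by rewrite gt_eqF //; lra.
have t0 : twist_den y x t != 0 by rewrite gt_eqF //; lra.
apply: (mulIf (mulf_neq0 t0 s0)); rewrite mulfVK ?mulf_neq0 //.
rewrite /twist /chart -!/(twist_den _ _ _).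
move: s0 t0; rewrite /twist_den /twist_vec /ushear /lshear /= => s0 t0.
by field; rewrite s0 t0.
Qed.

Lemma twist_contraction s t : small_twist -> 0 <= s <= 1 -> 0 <= t <= 1 ->
  3 / 4 * `|t - s| <= `|twist y x t - twist y x s|.
Proof.
move=> st s01 t01; rewrite twist_sub //.
have /andP[s1 s2] := twist_den_bounds st s01; have /andP[t1 t2] := twist_den_bounds st t01.
have D0 : 0 < twist_den y x t * twist_den y x s by rewrite mulr_gt0 //; lra.
rewrite normrM normfV (gtr0_norm D0) mulrC ler_wpM2l //.
rewrite -[leLHS]invrK lef_pV2 ?posrE //; nra.
Qed.
End Bounds.

Lemma twist_ratio y x t : twist_den y x t != 0 ->
  twist_vec y x (t, 1 - t) =
    (twist_den y x t * twist y x t, twist_den y x t * (1 - twist y x t)).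
Proof.
rewrite /twist /chart -/(twist_den y x t) => D0.
rewrite mulrBr mulr1 mulrCA divff // mulr1 /twist_den addrAC subrr add0r.
by case: (twist_vec _ _ _).
Qed.

End Twist.

(** * Reduced words act without fixed intervals *)

Lemma quadratic_three_roots (R : realType) (a b c t1 t2 t3 : R) :
  t1 != t2 -> t1 != t3 -> t2 != t3 ->
  (forall t, t \in [:: t1; t2; t3] -> a + b * t + c * t ^+ 2 = 0) ->
  a + b + c = 0.
Proof.
move=> t12 t13 t23 h.
pose p := a%:P + b *: 'X + c *: 'X^2.
have pE t : p.[t] = a + b * t + c * t ^+ 2 by rewrite /p !hornerE.
have p0 : p = 0.
  apply/eqP; apply: contraT => pn0.
  have : (size [:: t1; t2; t3] < size p)%N.
    apply: max_poly_roots => //=.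
      by rewrite /root !pE !h ?eqxx // !inE eqxx ?orbT.
    by rewrite !inE negb_or t12 t13 t23.
  rewrite ltnNge => /negP[]; rewrite /p.
  apply: leq_trans (size_polyD _ _) _; rewrite geq_max; apply/andP; split.
    apply: leq_trans (size_polyD _ _) _; rewrite geq_max size_polyC.
    by case: (a != 0); rewrite (leq_trans (size_scale_leq _ _)) ?size_polyX.
  by rewrite (leq_trans (size_scale_leq _ _)) ?size_polyXn.
by have := pE 1; rewrite p0 horner0 mulr1 expr1n mulr1 => <-.
Qed.

Section Walk.
Variables (R : realType) (x : R).
Local Notation ev P := ((map_poly intr P).[x]).

(** The vector [(p, q)] is the first column of a matrix built from shears,
    at a stage where the last factor is lower triangular; the empty product
    gives [(1, 0)]. *)
Definition column (p q : R) : Prop :=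
  (p = 1 /\ q = 0) \/
  exists P Q, [/\ dominated R P Q, p = ev P & q = ev Q].

Definition steep_value (d : R) : Prop := exists2 D, steep R D & d = ev D.

(** One upper factor with entry [d] followed by a lower one with entry [x]
    or [- x]. The initial vector [(1, 0)] is fixed by upper factors, so that
    it becomes [(1, x)] or [(1, - x)]. *)
Lemma column_step p q d (e : int) : column p q -> steep_value d -> `|e| = 1 ->
  exists P Q, [/\ dominated R P Q, p + d * q = ev P & q + e%:~R * x * (p + d * q) = ev Q].
Proof.
move=> pq [D Ds ->] e1; case: pq => [[-> ->]|[P [Q [PQ -> ->]]]].
  exists 1, (e *: 'X); split; first exact: dominated_start.
  - by rewrite mulr0 addr0 rmorph1 hornerE.
  - by rewrite mulr0 addr0 add0r mulr1 map_polyZ map_polyX !hornerE.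
exists (P + D * Q), (Q + (e *: 'X) * (P + D * Q)); split.
- exact: dominated_step.
- by rewrite !(rmorphD, rmorphM) /= !hornerE.
- by rewrite !(rmorphD, rmorphM) /= map_polyZ map_polyX !hornerE.
Qed.

(** The exponents start at 2 to have [offset i <= x / 8], which keeps the
    twists close to the identity and, in the last part, gives a pole of the
    twist to the left of 0. *)
Definition offset (i : nat) : R := x ^+ i.+2.

Lemma steep_offset i : steep_value (offset i - 0).
Proof.
by exists 'X^(i.+2); [exact: steepXn | rewrite map_polyXn hornerXn subr0].
Qed.

Lemma steep_offsetB i j : i != j -> steep_value (offset i - offset j).
Proof.
move=> ij; exists ('X^(i.+2) - 'X^(j.+2)).
  by apply: steepB => //; rewrite eq_sym.
by rewrite rmorphB /= !map_polyXn !hornerE.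
Qed.

Lemma twist_vecK y c (u v : R) (w := twist_vec y c (u, v)) :
  u = w.1 - y * w.2 - y * (w.2 - c * (w.1 - y * w.2)) /\
  v = w.2 - c * (w.1 - y * w.2).
Proof. by rewrite /w /twist_vec /ushear /lshear /=; split; ring. Qed.

Section Orbit.
Variables (n : nat) (h : 'I_n -> homeo R) (a b : R).
Hypothesis hx : forall i : 'I_n, small_twist x (offset i).
Hypothesis hE : forall (i : 'I_n) t, 0 <= t <= 1 -> h i t = twist (offset i) x t.
Implicit Types (g u : homeo R) (z : homeo R * 'I_n).

Definition unit_valued g : Prop := forall t, a <= t <= b -> 0 <= g t <= 1.

(** On the cell, [u] is the composite of [u0] with the projective map of
    matrix [ushear (- y)] times the matrix with columns [(p, q)] and [(B,
    D)]. The last upper factor is kept apart because it merges with the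
    first factor of the next twist. *)
Definition tracked u0 u y p q : Prop := exists B D,
  forall t, a <= t <= b -> exists l,
    let X := p * u0 t + B * (1 - u0 t) in
    let Y := q * u0 t + D * (1 - u0 t) in
    u t = l * (X - y * Y) /\ 1 - u t = l * Y.

(** A step goes from [u] to [u'] through the vertex [h i u = h i' u'], which
    multiplies the matrix by the twist of index [i] and by the inverse of
    the twist of index [i']. *)
Lemma tracked_step u0 u u' (i i' : 'I_n) y p q :
  unit_valued u -> unit_valued u' -> (forall t, h i' (u' t) = h i (u t)) ->
  tracked u0 u y p q ->
  let p1 := p + (offset i - y) * q in let q1 := q + x * p1 in
  let p2 := p1 + (offset i - offset i') * q1 in
  let q2 := q1 - x * p2 in
  tracked u0 u' (offset i') p2 q2.
Proof.
move=> uu uu' uE [B [D tr]] p1 q1 p2 q2.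
pose B1 := B + (offset i - y) * D; pose D1 := D + x * B1.
pose B2 := B1 + (offset i - offset i') * D1; pose D2 := D1 - x * B2.
exists B2, D2 => t tab; have [l /= [lX lY]] := tr t tab.
have u01 := uu t tab; have u'01 := uu' t tab.
have /andP[d1 _] := twist_den_bounds (hx i) u01.
have /andP[d1' _] := twist_den_bounds (hx i') u'01.
have dn : twist_den (offset i) x (u t) != 0 by rewrite gt_eqF //; lra.
have dn' : twist_den (offset i') x (u' t) != 0 by rewrite gt_eqF //; lra.
have := uE t; rewrite !hE // => tE.
have e := twist_ratio dn; have := twist_ratio dn'; rewrite tE => e'.
set d := twist_den _ _ (u t) in e dn d1.
set d' := twist_den _ _ (u' t) in e' dn' d1'.
exists (l * (d' / d)) => /=.
have eX : (twist_vec (offset i') x (u' t, 1 - u' t)).1 =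
    d' / d * (twist_vec (offset i) x (u t, 1 - u t)).1.
  by rewrite e e' /=; field.
have eY : (twist_vec (offset i') x (u' t, 1 - u' t)).2 =
    d' / d * (twist_vec (offset i) x (u t, 1 - u t)).2.
  by rewrite e e' /=; field.
have [uE' vE'] := twist_vecK (offset i') x (u' t) (1 - u' t).
rewrite /q2 /p2 /q1 /p1 /D2 /B2 /D1 /B1.
by split; [rewrite uE'|rewrite vE']; rewrite eX eY /twist_vec /ushear /lshear /= lY lX; ring.
Qed.

(** A projective map with three fixed points is the identity. *)
Lemma tracked_loop u0 y p q : a < b -> tracked u0 u0 y p q -> q = 0.
Proof.
move=> ab [B [D tr]]; pose m := (a + b) / 2.
have u0I : injective u0 := can_inj (homeo_funK u0).
have neq s t : s < t -> u0 s != u0 t by move=> st; rewrite inj_eq // lt_eqF.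
have inab t : t \in [:: a; m; b] -> a <= t <= b.
  by rewrite !inE => /or3P[] /eqP->; rewrite /m; apply/andP; split; lra.
have am : a < m by rewrite /m; lra. have mb : m < b by rewrite /m; lra.
have := @quadratic_three_roots R (B - y * D) (p - y * q - 2 * (B - y * D) - D)
  (D - q - (p - y * q) + (B - y * D)) _ _ _ (neq _ _ am) (neq _ _ ab) (neq _ _ mb).
move=> quad; have /eqP : B - y * D + (p - y * q - 2 * (B - y * D) - D) +
    (D - q - (p - y * q) + (B - y * D)) = 0.
  apply: quad => t tm.
  have [s sab ->] : exists2 s, a <= s <= b & t = u0 s.
    by move: tm; rewrite !inE => /or3P[] /eqP->; eexists; try reflexivity;
      apply: inab; rewrite !inE eqxx ?orbT.
  have [l /=[lX lY]] := tr s sab.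
  set X := p * _ + _ in lX lY; set Y := q * _ + _ in lX lY.
  have : (X - y * Y) * (1 - u0 s) - Y * u0 s = 0 by rewrite lY lX; ring.
  by move=> e; rewrite -[RHS]e /X /Y; ring.
by rewrite -oppr_eq0 => /eqP e; rewrite -[RHS]e; ring.
Qed.

(** If no edge is a leaf, a walk that never turns back stays among finitely
    many edges, hence closes up. The walk reads an alternating product of
    twists and inverses of twists; since it never turns back, consecutive
    indices differ and [column_step] shows that the lower left entry is the
    value at [x] of a polynomial that [x] avoids. But this entry is 0 by
    [tracked_loop]. *)
Lemma acyclic_edges (E : {fset homeo R * 'I_n}) : avoids x -> a < b ->
  (forall z, z \in E -> unit_valued z.1) ->
  forest (fun z => z.1) (fun z => h z.2 * z.1)%g E.
Proof.
move=> avx ab uE E' E'E E'0; apply: contrapT => nleaf.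
(* [i'] is the index of the edge that arrives at the left end of [z'] *)
pose step z z' := exists i', [/\ forall t, h i' (z'.1 t) = h z.2 (z.1 t), i' != z.2 & z'.2 != i'].
have nxt z : exists z', z \in E' -> z' \in E' /\ step z z'.
  have [zE|] := boolP (z \in E'); last by exists z.
  have [z1 [z1E rz1 z1z]] : exists z1, [/\ z1 \in E', (h z1.2 * z1.1 = h z.2 * z.1)%g & z1 <> z].
    apply: contrapT => no; apply: nleaf; exists z => //; right => w wE rw.
    by apply: contrapT => wz; apply: no; exists w.
  have [z2 [z2E lz2 z2z]] : exists z2, [/\ z2 \in E', z2.1 = z1.1 & z2 <> z1].
    apply: contrapT => no; apply: nleaf; exists z1 => //; left => w wE rw.
    by apply: contrapT => wz; apply: no; exists w.
  exists z2 => _; split=> //; exists z1.2; split.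
  - move=> t; rewrite lz2.
    by have /(congr1 (fun f : homeo R => f t)) := rz1.
  - apply/eqP => e; apply: z1z; move: rz1; rewrite e => /mulgI e1.
    by rewrite (surjective_pairing z1) (surjective_pairing z) e1 e.
  - apply/eqP => e; apply: z2z.
    by rewrite (surjective_pairing z1) (surjective_pairing z2) lz2 e.
pose f z := projT1 (cid (nxt z)).
have fP z : z \in E' -> f z \in E' /\ step z (f z) by rewrite /f; case: cid.
have [z0 z0E [m fz0]] := iter_cycle E'0 (fun z zE => (fP z zE).1).
have itE k : iter k f z0 \in E' by elim: k => //= k /fP[].
have uE' z : z \in E' -> unit_valued z.1 by move=> /(fsubsetP E'E)/uE.
(* the walk starts at [visited z0], where the column is still [(1, 0)] *)
pose visited z := exists y p q,
  [/\ steep_value (offset z.2 - y), column p q & tracked z0.1 z.1 y p q].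
pose moved z := exists y P Q,
  [/\ steep_value (offset z.2 - y), dominated R P Q &
   tracked z0.1 z.1 y (ev P) (ev Q)].
have visited0 : visited z0.
  exists 0, 1, 0; split; [exact: steep_offset|by left|].
  by exists 0, 1 => t tab; exists 1; split; ring.
have moved_visited z : moved z -> visited z.
  by move=> [y [P [Q [sy PQ tr]]]]; exists y, (ev P), (ev Q); split=> //; right; exists P, Q.
have move1 z : z \in E' -> visited z -> moved (f z).
  move=> zE [y [p [q [sy pq tr]]]]; have [fE [i' [hz i'z fi']]] := fP z zE.
  have := tracked_step (uE' _ zE) (uE' _ fE) hz tr => /=.
  have [P [Q [PQ pE qE]]] := column_step pq sy (normr1 int).
  rewrite mul1r pE in qE; rewrite pE qE.
  have PQc : column (ev P) (ev Q) by right; exists P, Q.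
  have si : steep_value (offset z.2 - offset i') by apply: steep_offsetB; rewrite eq_sym.
  have [P2 [Q2 [PQ2 pE2 qE2]]] := column_step PQc si (normrN1 int).
  rewrite mulN1r mulNr pE2 in qE2.
  rewrite pE2 qE2 => tr2; exists (offset i'), P2, Q2; split=> //.
  exact: steep_offsetB.
have movedS k : moved (iter k.+1 f z0).
  elim: k => [|k IHk]; first exact: move1.
  by apply: move1 (moved_visited _ IHk); exact: itE.
have := movedS m; rewrite fz0 => -[y [P [Q [_ /dominated_exterior/avx Q0 tr]]]].
by rewrite (tracked_loop ab tr) eqxx in Q0.
Qed.

End Orbit.
End Walk.

(** * Cells of the line *)

Section Cells.
Variable R : realType.
Implicit Types (f : R -> R) (g : homeo R) (s : seq R) (p t : R).

Definition cells p s : seq (R * R) := zip (p :: s) s.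

Lemma cells_sum f p s : {homo f : u v / u <= v} -> path <=%R p s ->
  \sum_(c <- cells p s) `|f c.2 - f c.1| = f (last p s) - f p.
Proof.
move=> fhomo; rewrite /cells; elim: s p => [|q s IHs] p /=.
  by rewrite big_nil subrr.
move=> /andP[pq qs]; rewrite big_cons IHs //= ger0_norm ?subr_ge0 ?fhomo //.
by rewrite addrC subrKA.
Qed.

Lemma cellsP p s c : path <%R p s -> c \in cells p s ->
  [/\ p <= c.1, c.1 < c.2 & forall z, z \in p :: s -> z <= c.1 \/ c.2 <= z].
Proof.
rewrite /cells; elim: s p => [//|q s IHs] p /= /andP[pq qs].
have qz z : z \in s -> q <= z.
  by move: qs; rewrite lt_path_sortedE => /andP[/allP h _] /h /ltW.
rewrite inE => /orP[/eqP-> /=|cE].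
  by split=> // z; rewrite !inE => /or3P[/eqP->|/eqP->|/qz]; [left|right|right].
have [qc c12 cz] := IHs q qs cE.
have pc : p <= c.1 by rewrite (le_trans (ltW pq)).
by split=> // z; rewrite inE => /orP[/eqP->|/cz //]; left.
Qed.

(** Length inside [0, 1] is measured as the variation of [clamp \o g], so
    that sums over cells telescope. *)
Definition clamp t : R := if t <= 0 then 0 else if t <= 1 then t else 1.

Lemma clamp_homo : {homo clamp : u v / u <= v}.
Proof.
by move=> u v uv; rewrite /clamp; case: (leP u 0); case: (leP v 0);
  case: (leP u 1); case: (leP v 1); lra.
Qed.

Lemma clamp_id t : 0 <= t <= 1 -> clamp t = t.
Proof. by rewrite /clamp; case: (leP t 0); case: (leP t 1); lra. Qed.

Lemma homeo_mono (g : homeo R) :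
  {homo g : u v / u <= v} \/ {homo (fun t => - g t) : u v / u <= v}.
Proof.
have gc : {within [set` `]-oo, +oo[], continuous g}.
  by apply: continuous_subspaceT; exact: homeo_fun_continuous.
have gI := in2W (can_inj (homeo_funK g)).
have [h|h] := unstable.strict_monotonicW (itv_continuous_inj_mono gc (gI _ _)).
- by left => u v uv; rewrite h ?in_itv.
- by right => u v uv; rewrite lerN2 h ?in_itv.
Qed.

Definition unit_variation (g : homeo R) (c : R * R) : R := `|clamp (g c.2) - clamp (g c.1)|.

Lemma path_between p s t : path <=%R p s -> t \in p :: s -> p <= t <= last p s.
Proof.
elim: s p t => [|q s IHs] p t; first by rewrite inE => _ /eqP->; rewrite lexx.
move=> /= /andP[pq qs]; rewrite inE => /orP[/eqP->|/(IHs q t qs)/andP[qt ->]].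
  by rewrite lexx (le_trans pq) //; case/andP: (IHs q q qs (mem_head _ _)).
by rewrite (le_trans pq).
Qed.

Lemma unit_variation_sum g p s : path <%R p s ->
  \sum_(c <- cells p s) unit_variation g c = unit_variation g (p, last p s).
Proof.
move=> ps; have ps' : path <=%R p s by apply: sub_path ps => u v /ltW.
rewrite /unit_variation; have [gh|gh] := homeo_mono g.
- have ch : {homo (clamp \o g) : u v / u <= v} by move=> u v /gh; exact: clamp_homo.
  rewrite (cells_sum ch ps') ger0_norm // subr_ge0.
  by apply: ch; case/andP: (path_between ps' (mem_head _ _)).
- have ch : {homo (fun t => - clamp (g t)) : u v / u <= v}.
    by move=> u v /gh; rewrite !lerN2; exact: clamp_homo.
  have flip (u v : R) : `|u - v| = `|- u - - v| by rewrite -opprD normrN.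
  rewrite (eq_bigr (fun c => `|- clamp (g c.2) - - clamp (g c.1)|));
    last by move=> c _; exact: flip.
  rewrite (cells_sum ch ps') flip ger0_norm // subr_ge0.
  by apply: ch; case/andP: (path_between ps' (mem_head _ _)).
Qed.

Lemma unit_variation_le1 g c : unit_variation g c <= 1.
Proof.
have c01 t : 0 <= clamp t <= 1.
  by rewrite /clamp; case: (leP t 0); case: (leP t 1); lra.
rewrite /unit_variation ler_norml; have := c01 (g c.1); have := c01 (g c.2); lra.
Qed.

Lemma unit_variation1 g p q : p <= homeo_inv g 0 <= q -> p <= homeo_inv g 1 <= q ->
  unit_variation g (p, q) = 1.
Proof.
move=> /andP[p0 q0] /andP[p1 q1]; rewrite /unit_variation /=.
have [h|h] := homeo_mono g.
- have := h _ _ p0; have := h _ _ q1; rewrite !homeo_invK /clamp => g1 g0.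
  rewrite g0 (_ : (g q <= 0) = false) ?subr0; last by apply/negbTE; rewrite -ltNge; lra.
  by case: leP => ?; rewrite ?normr1 // (_ : g q = 1) ?normr1 //; lra.
- have := h _ _ p1; have := h _ _ q0; rewrite !homeo_invK !lerN2 /clamp => g0 g1.
  rewrite g0 (_ : (g p <= 0) = false) ?sub0r ?normrN; last by apply/negbTE; rewrite -ltNge; lra.
  by case: leP => ?; rewrite ?normr1 // (_ : g p = 1) ?normr1 //; lra.
Qed.

(** The points [g^-1 0] and [g^-1 1] are not inside the cell, so by
    monotonicity the image of the cell does not cross 0 or 1. *)
Lemma unit_variation_cell g (c : R * R) : c.1 < c.2 ->
  homeo_inv g 0 <= c.1 \/ c.2 <= homeo_inv g 0 ->
  homeo_inv g 1 <= c.1 \/ c.2 <= homeo_inv g 1 ->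
  unit_valued c.1 c.2 g \/ unit_variation g c = 0.
Proof.
move=> c12; have E v : homeo_inv g v <= c.1 \/ c.2 <= homeo_inv g v ->
    (v <= g c.1 /\ v <= g c.2) \/ (g c.1 <= v /\ g c.2 <= v).
  have [h|h] := homeo_mono g; case=> hv.
  - by left; split; rewrite -[v](homeo_invK g); apply: h; rewrite // (le_trans hv) // ltW.
  - by right; split; rewrite -[v](homeo_invK g); apply: h; rewrite // (le_trans _ hv) // ltW.
  - by right; split; rewrite -[v](homeo_invK g) -lerN2; apply: h; rewrite // (le_trans hv) // ltW.
  - by left; split; rewrite -[v](homeo_invK g) -lerN2; apply: h; rewrite // (le_trans _ hv) // ltW.
move=> /E h0 /E h1; rewrite /unit_variation /clamp.
have neg (t : R) : t <= 0 -> (if t <= 0 then 0 else if t <= 1 then t else 1) = 0 by move=> ->.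
have pos (t : R) : 1 <= t -> (if t <= 0 then 0 else if t <= 1 then t else 1) = 1.
  by move=> t1; rewrite leNgt (lt_le_trans ltr01 t1) /=; case: leP => // ?; lra.
case: h0 => -[a0 b0]; last by right; rewrite !neg // subrr normr0.
case: h1 => -[a1 b1]; first by right; rewrite !pos // subrr normr0.
left => t /andP[t1 t2]; have [h|h] := homeo_mono g.
- by have := h _ _ t1; have := h _ _ t2; lra.
- by have := h _ _ t1; have := h _ _ t2; lra.
Qed.

End Cells.

(** * Doubling of finite sets of homeomorphisms *)

Section Doubling.
Local Open Scope fset_scope.
Local Open Scope ring_scope.
Variables (R : realType) (x : R) (h : 'I_4 -> homeo R).

Definition twisting : Prop :=
  forall (i : 'I_4) t, 0 <= t <= 1 -> h i t = twist (offset x i) x t.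

Lemma small_twist_offset i : 0 < x <= 8^-1 -> small_twist x (offset x i).
Proof.
move=> /andP[x0 x8]; have x2 : x ^+ 2 <= x / 8 by rewrite expr2 ler_pM2l.
split=> //; first by rewrite exprn_gt0.
apply: le_trans x2; rewrite /offset -addn2 exprD ler_piMl ?exprn_ge0 ?(ltW x0) //.
by apply: exprn_ile1; [exact: ltW | lra].
Qed.

Hypotheses (hx : 0 < x <= 8^-1) (avx : avoids x) (hE : twisting).

Lemma unit_variation_translate (c : R * R) (g : homeo R) (i : 'I_4) : c.1 <= c.2 ->
  unit_valued c.1 c.2 g -> 3 / 4 * unit_variation g c <= unit_variation (h i * g)%g c.
Proof.
move=> c12 ug; have st := small_twist_offset i hx.
have u1 : 0 <= g c.1 <= 1 by apply: ug; rewrite lexx.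
have u2 : 0 <= g c.2 <= 1 by apply: ug; rewrite lexx andbT.
rewrite /unit_variation -[(h i * g)%g c.1]/(h i (g c.1)) -[(h i * g)%g c.2]/(h i (g c.2)).
by rewrite !hE // !clamp_id ?twist_itv // twist_contraction.
Qed.

(** The forest inequality over one cell: each element [g] of [F] that maps
    the cell into [0, 1] is on four edges of weight [3 / 4 * unit_variation
    g c]. *)
Lemma unit_variation_doubling (F : {fset homeo R}) (c : R * R) : c.1 < c.2 ->
  (forall g, g \in F -> unit_valued c.1 c.2 g \/ unit_variation g c = 0) ->
  2 * (\sum_(g <- F) unit_variation g c) <= \sum_(g <- translates h F) unit_variation g c.
Proof.
move=> c12 Fc.
pose F' := [fset g in F | `[< unit_valued c.1 c.2 g >]].
pose B := [fset i in enum 'I_4].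
have cB : #|` B| = 4 by rewrite card_fseq undup_id ?enum_uniq // size_enum_ord.
pose E := F' `*` B.
have inE z : z \in E -> z.1 \in F /\ unit_valued c.1 c.2 z.1.
  by rewrite in_fsetM => /andP[]; rewrite !inE /= => /andP[? /asboolP ?].
have v0 g : 0 <= unit_variation g c by exact: normr_ge0.
have := @forest_weight R _ _ _ (fun z : homeo R * 'I_4 => z.1)
  (fun z => h z.2 * z.1)%g E (fun g => unit_variation g c) (fun g => unit_variation g c)
  (fun z => 3 / 4 * unit_variation z.1 c) v0 v0.
have vF' : \sum_(g <- F) unit_variation g c = \sum_(g <- F') unit_variation g c.
  rewrite /F' big_fset /= (big_fsetID _ (fun g => `[< unit_valued c.1 c.2 g >])) /=.
  rewrite !big_fset /= -[RHS]addr0; congr (_ + _).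
  rewrite big_seq_cond big1 // => g /andP[gF /asboolPn ng].
  by have [] := Fc g gF.
have -> : \sum_(z <- E) 3 / 4 * unit_variation z.1 c = 3 * \sum_(g <- F) unit_variation g c.
  rewrite vF' /E /fsetM big_imfset2 /=; last by move=> [? ?] [? ?] _ _ [-> ->].
  rewrite mulr_sumr; apply: eq_bigr => g _.
  rewrite big_const_seq count_predT cB iter_addr_0 -mulr_natr; lra.
have lE : (fun z : homeo R * 'I_4 => z.1) @` E `<=` F.
  by apply/fsubsetP => _ /imfsetP[z /= /inE[zF _] ->].
have rE : (fun z : homeo R * 'I_4 => h z.2 * z.1)%g @` E `<=` translates h F.
  apply/fsubsetP => _ /imfsetP[z /= /inE[zF _] ->]; apply/translatesP.
  by exists z.1 => //; exists z.2.
have lS := big_fset_le v0 lE; have rS := big_fset_le v0 rE.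
have cl z : z \in E -> 3 / 4 * unit_variation z.1 c <= unit_variation z.1 c.
  by move=> _; have := v0 z.1; lra.
have cr z : z \in E -> 3 / 4 * unit_variation z.1 c <= unit_variation (h z.2 * z.1)%g c.
  by move=> /inE[_ zu]; apply: unit_variation_translate => //; exact: ltW.
have acyc : forest (fun z => z.1) (fun z => h z.2 * z.1)%g E.
  apply: (acyclic_edges (fun i => small_twist_offset i hx) hE avx c12).
  by move=> z /inE[].
by move=> /(_ cl cr acyc) fw; move: lS rS fw; lra.
Qed.

Theorem translates_doubling (F : {fset homeo R}) : (2 * #|` F| <= #|` translates h F|)%N.
Proof.
have [->|/fset0Pn[g0 g0F]] := eqVneq F fset0; first by rewrite cardfs0 muln0.
(* the cells are bounded by the points where some element of [F] takes the value 0 or 1 *)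
pose pts := undup (flatten [seq [:: homeo_inv g 0; homeo_inv g 1] | g : homeo R <- F]).
have ptsP g : g \in F -> homeo_inv g 0 \in pts /\ homeo_inv g 1 \in pts.
  by move=> gF; rewrite !mem_undup; split; apply/flattenP;
    exists [:: homeo_inv g 0; homeo_inv g 1]; rewrite ?inE ?eqxx ?orbT //;
    apply/mapP; exists g.
have : sorted <%R (sort <=%R pts) by rewrite sort_lt_sorted undup_uniq.
have ptsS t : t \in pts -> t \in sort <=%R pts by rewrite mem_sort.
case: (sort _ _) ptsS => [/(_ _ (ptsP _ g0F).1) //|p s] ptsS /= ps.
have between t : t \in pts -> p <= t <= last p s.
  by move/ptsS; apply: path_between; apply: sub_path ps => u v /ltW.
have card_sum (E : {fset homeo R}) : #|` E|%:R = \sum_(g <- E) 1 :> R.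
  by rewrite big_const_seq count_predT iter_addr_0.
rewrite -(ler_nat R) natrM !card_sum.
have vF g : g \in F -> \sum_(c <- cells p s) unit_variation g c = 1.
  by move=> /ptsP[g0p g1p]; rewrite unit_variation_sum // unit_variation1 // between.
rewrite (eq_big_seq _ (fun g gF => esym (vF g gF))).
apply: le_trans (_ : \sum_(g <- translates h F) \sum_(c <- cells p s) unit_variation g c <= _);
  last by apply: ler_sum => g _; rewrite unit_variation_sum // unit_variation_le1.
rewrite exchange_big [leRHS]exchange_big /= mulr_sumr.
rewrite big_seq_cond [leRHS]big_seq_cond; apply: ler_sum => c; rewrite andbT => cE.
have [_ c12 cz] := cellsP ps cE.
apply: unit_variation_doubling => // g /ptsP[/ptsS/cz g0p /ptsS/cz g1p].
exact: unit_variation_cell.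
Qed.

End Doubling.

Theorem twisting_paradoxical (R : realType) (x : R) (h : 'I_4 -> homeo R)
    (L : set (homeo R)) :
  0 < x <= 8^-1 -> avoids x -> twisting x h -> L 1%g ->
  (forall i g, L g -> L (h i * g)%g) -> (forall i g, L g -> L ((h i)^-1 * g)%g) ->
  paradoxical L 4 4.
Proof.
by move=> hx avx hE L1 hL VL; apply: paradoxical_of_doubling L1 hL VL _;
  exact: translates_doubling hx avx hE.
Qed.

(** * The Lodha-Moore groups *)

Section Realization.
Variable R : realType.
Implicit Types (f g : homeo R) (phi psi : R * R -> R * R) (v : R * R).

Definition nonneg_vec v : Prop := [/\ 0 <= v.1, 0 <= v.2 & 0 < v.1 + v.2].

(** [f] is given on [0, 1] by the homogeneous map [phi], in the coordinate
    [chart]. *)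
Definition realizes f phi : Prop :=
  forall v, nonneg_vec v -> nonneg_vec (phi v) /\ f (chart v) = chart (phi v).

Lemma realizesM f g phi psi : realizes f phi -> realizes g psi ->
  realizes (f * g)%g (phi \o psi).
Proof.
move=> fphi gpsi v /gpsi[pv gv]; have [pp fv] := fphi _ pv; split=> //.
by rewrite -[LHS]/(f (g (chart v))) gv fv.
Qed.

Lemma realizes_scale f phi psi (l : R) : 0 < l -> realizes f phi ->
  (forall v, phi v = (l * (psi v).1, l * (psi v).2)) -> realizes f psi.
Proof.
move=> l0 fphi pE v /fphi[]; rewrite pE => -[/= p1 p2 p3] ->.
rewrite -mulrDr in p3; rewrite !pmulr_rge0 // in p1 p2; rewrite pmulr_rgt0 // in p3.
split=> //; rewrite /chart /= -mulrDr invfM mulrACA divff ?mul1r //.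
by rewrite gt_eqF.
Qed.

Lemma realizesX f (p q : R) k : 
  realizes f (fun v => (p * v.1, q * v.2)) ->
  realizes (f ^+ k)%g (fun v => (p ^+ k * v.1, q ^+ k * v.2)).
Proof.
move=> fp; elim: k => [|k IHk].
  by move=> [a b] vab; rewrite /= !expr0 !mul1r.
move=> v vv; have [w1 w2] := realizesM fp IHk vv.
by rewrite expgS !exprS -!mulrA.
Qed.

Lemma chart_itv v : nonneg_vec v -> 0 <= chart v <= 1.
Proof.
by move=> [v1 v2 v12]; rewrite /chart divr_ge0 ?(ltW v12) //= ler_pdivrMr // mul1r lerDl.
Qed.

(** In the coordinate [s = v.1 / v.2], the map [c] is [s |-> 2 s]. *)
Lemma realizes_c : realizes (map_c R) (fun v => (2 * v.1, 1 * v.2)).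
Proof.
move=> v vv; have [v1 v2 v12] := vv; split; first by split=> /=; lra.
rewrite -[LHS]/(c_fun (chart v)) /c_fun (chart_itv vv) /chart /=.
by field; apply/andP; split; apply/eqP; lra.
Qed.

Lemma realizes_cV : realizes (map_c R)^-1%g (fun v => (1 * v.1, 2 * v.2)).
Proof.
move=> v vv; have [v1 v2 v12] := vv; split; first by split=> /=; lra.
rewrite -[LHS]/(c_inv (chart v)) /c_inv (chart_itv vv) /chart /=.
by field; apply/andP; split; apply/eqP; lra.
Qed.

(** In the coordinate [s = v.1 / v.2], the inverse of [b] is [s |-> s / (1 +
    s)]. *)
Lemma realizes_bV : realizes (map_b R)^-1%g (lshear 1).
Proof.
move=> v vv; have [v1 v2 v12] := vv; split; first by split=> /=; lra.
rewrite -[LHS]/(b_inv (chart v)) /b_inv.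
have /andP[c0 c1] := chart_itv vv; rewrite c1.
case: leP => [c0'|_].
  have -> : chart v = 0 by lra.
  have e : v.1 = 0.
    have : chart v = 0 by lra.
    by rewrite /chart => /eqP; rewrite mulf_eq0 invr_eq0 (gt_eqF v12) orbF => /eqP.
  by rewrite /chart /= e mul0r.
by rewrite /chart /=; field; apply/andP; split; apply/eqP; lra.
Qed.

(** In the coordinate [s = v.1 / v.2], this is [s |-> s + 1]. *)
Lemma realizes_bVa : realizes ((map_b R)^-1 * map_a R)%g (ushear 1).
Proof.
move=> v vv; have [v1 v2 v12] := vv; split; first by split=> /=; lra.
rewrite -[LHS]/(b_inv (chart v + 1)) /b_inv.
have /andP[c0 c1] := chart_itv vv.
have n : v.1 + v.2 != 0 by rewrite gt_eqF.
rewrite leNgt (_ : 0 < chart v + 1) /=; last by lra.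
case: leP => [c0'|_].
  have -> : chart v = 0 by lra.
  have e : v.1 = 0.
    have : chart v = 0 by lra.
    by rewrite /chart => /eqP; rewrite mulf_eq0 invr_eq0 (gt_eqF v12) orbF => /eqP.
  by rewrite /chart /= e; field; apply/eqP; lra.
rewrite (_ : chart v + 1 <= 2) /=; last by lra.
by rewrite /chart /=; field; rewrite n andbT; apply/eqP; lra.
Qed.

(** Conjugation by powers of [c] rescales the entry of a shear by powers of
    2. *)
Definition dyadic_ushear k := ((map_c R)^-1 ^+ k * ((map_b R)^-1 * map_a R) * map_c R ^+ k)%g.
Definition dyadic_lshear k := (map_c R ^+ k * (map_b R)^-1 * (map_c R)^-1 ^+ k)%g.

Lemma realizes_dyadic_ushear k : realizes (dyadic_ushear k) (ushear (2^-1 ^+ k)).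
Proof.
have h := realizesM (realizesM (realizesX k realizes_cV) realizes_bVa) (realizesX k realizes_c).
have p0 : 0 < 2 ^+ k :> R by rewrite exprn_gt0.
apply: (realizes_scale p0 h) => v; rewrite /ushear /= !expr1n exprVn.
have pn := lt0r_neq0 p0. congr (_, _); [by field|by rewrite mul1r].
Qed.

Lemma realizes_dyadic_lshear k : realizes (dyadic_lshear k) (lshear (2^-1 ^+ k)).
Proof.
have h := realizesM (realizesM (realizesX k realizes_c) realizes_bV) (realizesX k realizes_cV).
have p0 : 0 < 2 ^+ k :> R by rewrite exprn_gt0.
apply: (realizes_scale p0 h) => v; rewrite /lshear /= !expr1n exprVn.
have pn := lt0r_neq0 p0; congr (_, _); [by rewrite mul1r|by field].
Qed.

Definition dyadic_twist k (i : 'I_4) : homeo R :=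
  (dyadic_ushear (k * i.+2) * dyadic_lshear k * dyadic_ushear (k * i.+2))%g.

Lemma dyadic_twisting k : twisting (2^-1 ^+ k) (dyadic_twist k).
Proof.
move=> i t t01; rewrite /twist /offset -exprM.
have tv : nonneg_vec (t, 1 - t) by split=> /=; lra.
have := realizesM (realizesM (realizes_dyadic_ushear (k * i.+2)) (realizes_dyadic_lshear k))
  (realizes_dyadic_ushear (k * i.+2)).
by case/(_ _ tv) => _; rewrite {1}/chart /= [t + _]addrC subrK divr1.
Qed.
End Realization.

Section Subgroups.
Variable G : groupType.
Implicit Types (L X : set G).

Lemma subgroupV L g : subgroup L -> L g -> L g^-1%g.
Proof. by move=> [L1 LV] Lg; rewrite -[g^-1%g]mul1g; apply: LV. Qed.

Lemma subgroupM L f g : subgroup L -> L f -> L g -> L (f * g)%g.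
Proof. by move=> LL Lf Lg; rewrite -[g]invgK; apply: LL.2 => //; exact: subgroupV. Qed.

Lemma subgroupX L g k : subgroup L -> L g -> L (g ^+ k)%g.
Proof.
move=> LL Lg; elim: k => [|k IHk]; first exact: LL.1.
by rewrite expgS; exact: subgroupM.
Qed.

Lemma generated_sub X : X `<=` generated X.
Proof. by move=> g Xg L [_]; apply. Qed.
End Subgroups.

Lemma dyadic_paradoxical (R : realType) (L : set (homeo R)) : subgroup L ->
  L (map_a R) -> L (map_b R) -> L (map_c R) ->
  paradoxical L 4 4.
Proof.
move=> LL La Lb Lc; have half : 0 < (2^-1 : R) < 1 by lra.
have [k hx avx] := small_power_avoiding_roots half.
have Lt i : L (dyadic_twist R k i).
  have Lsh m : L (dyadic_ushear R m).
    by do !apply: subgroupM => //; try apply: subgroupX => //; apply: subgroupV.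
  have Ll m : L (dyadic_lshear R m).
    by do !apply: subgroupM => //; try apply: subgroupX => //; apply: subgroupV.
  exact: (subgroupM LL (subgroupM LL (Lsh _) (Ll _)) (Lsh _)).
apply: (twisting_paradoxical hx avx (dyadic_twisting k) LL.1) => i g Lg.
  exact: subgroupM.
by apply: subgroupM => //; exact: subgroupV.
Qed.

Lemma LM_G0_paradoxical (R : realType) : paradoxical (LM_G0 R) 4 4.
Proof.
apply: dyadic_paradoxical; first exact: generated_subgroup.
all: by apply: generated_sub; rewrite /=; tauto.
Qed.

Lemma LM_G_paradoxical (R : realType) : paradoxical (LM_G R) 4 4.
Proof.
apply: dyadic_paradoxical; first exact: generated_subgroup.
all: by apply: generated_sub; left; apply: generated_sub; rewrite /=; tauto.
Qed.

(** * Projective transformations of the projective line *)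

Section Compactify.
Variable T : topologicalType.
Local Notation opc := (one_point_compactification T).

(** Continuity at infinity: the preimage of a compact set is its image under
    the continuous inverse. *)
Lemma opc_map_continuous (f g : T -> T) : cancel f g -> cancel g f ->
  continuous f -> continuous g -> continuous (omap f : opc -> opc).
Proof.
move=> fK gK cf cg [x|] U /=; first by move=> /cf.
move=> [C [cC clC] CU]; exists (f @^-1` C).
  split; last by apply: closed_comp clC => t _; exact: cf.
  suff -> : f @^-1` C = g @` C.
    by apply: continuous_compact cC; exact: continuous_subspaceT.
  apply/seteqP; split=> [t Ct|_ [t Ct <-]]; last by rewrite /= gK.
  by exists (f t) => //; exact: fK.
move=> [t|] /= Ut; apply: CU; last by right.
by case: Ut => [[s Cs [<-]]|//]; left; exists (f s).
Qed.

Lemma omapK (f g : T -> T) : cancel f g -> cancel (omap f : opc -> opc) (omap g).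
Proof. by move=> fK [x|] //=; rewrite fK. Qed.

Definition homeo_opc (h : homeo T) : homeo opc :=
  Homeo (omapK (homeo_funK h)) (omapK (homeo_invK h))
    (opc_map_continuous (homeo_funK h) (homeo_invK h)
       (@homeo_fun_continuous _ h) (@homeo_inv_continuous _ h))
    (opc_map_continuous (homeo_invK h) (homeo_funK h)
       (@homeo_inv_continuous _ h) (@homeo_fun_continuous _ h)).
End Compactify.

Section Mobius.
Variable R : realType.
Implicit Types (M N : 'M[R]_2) (z : P1 R) (v : R * R).

Definition homogeneous z : R * R := if z is Some t then (t, 1) else (1, 0).
Definition projective v : P1 R := if v.2 == 0 then None else Some (v.1 / v.2).
Definition act M v : R * R := (M 0 0 * v.1 + M 0 1 * v.2, M 1 0 * v.1 + M 1 1 * v.2).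

Lemma mobiusE M z : mobius M z = projective (act M (homogeneous z)).
Proof. by case: z => [t|]; rewrite /mobius /projective /act /= ?mulr1 ?mulr0 ?addr0. Qed.

Lemma projective_scale (l : R) v : l != 0 -> projective (l * v.1, l * v.2) = projective v.
Proof.
move=> l0; rewrite /projective /= mulf_eq0 (negbTE l0) /=; case: ifP => // v20.
by congr Some; rewrite invfM mulrACA divff // mul1r.
Qed.

Lemma homogeneous_projective v : v != 0 -> exists2 l, l != 0 &
  v = (l * (homogeneous (projective v)).1, l * (homogeneous (projective v)).2).
Proof.
case: v => a b; rewrite /projective /= => v0; case: ifPn => b0 /=.
  exists a; rewrite /= ?mulr1 ?mulr0 ?(eqP b0) //.
  by apply: contraNneq v0 => ->; rewrite (eqP b0).
by exists b; rewrite // mulr1 mulrC divfK.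
Qed.

Lemma mulmx2E M N i j : (M *m N) i j = M i 0 * N 0 j + M i 1 * N 1 j.
Proof.
rewrite mxE !big_ord_recl big_ord0 addr0.
by congr (_ * _ + _ * _); congr fun_of_matrix; apply: val_inj.
Qed.

Lemma det2E M : \det M = M 0 0 * M 1 1 - M 0 1 * M 1 0.
Proof.
rewrite (expand_det_row _ 0) !big_ord_recl big_ord0 addr0 /cofactor !det_mx11 !mxE /=.
rewrite expr0 mul1r [X in (-1) ^+ X]/= expr1 mulN1r mulrN.
by congr (_ * _ - _ * _); congr fun_of_matrix; apply: val_inj.
Qed.

Lemma actM M N v : act (M *m N) v = act M (act N v).
Proof. by rewrite /act !mulmx2E /=; congr (_, _); ring. Qed.

Lemma act_neq0 M v : \det M = 1 -> v != 0 -> act M v != 0.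
Proof.
rewrite det2E => dM; apply: contraNneq => -[e1 e2]; apply/eqP.
have h1 : v.1 = M 1 1 * (act M v).1 - M 0 1 * (act M v).2.
  by rewrite -[LHS]mul1r -dM /act /=; ring.
have h2 : v.2 = M 0 0 * (act M v).2 - M 1 0 * (act M v).1.
  by rewrite -[LHS]mul1r -dM /act /=; ring.
rewrite [LHS]surjective_pairing h1 h2 /act /= e1 e2 !mulr0 subr0.
by [].
Qed.

Lemma mobiusM M N z : \det M = 1 -> \det N = 1 -> mobius (M *m N) z = mobius M (mobius N z).
Proof.
move=> dM dN; rewrite !mobiusE actM.
have z0 : homogeneous z != 0.
  by case: z => [t|]; apply/eqP; case; [move=> _ /eqP|move=> /eqP]; rewrite oner_eq0.
have [l l0 e] := homogeneous_projective (act_neq0 dN z0).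
rewrite {1}e -[RHS](projective_scale _ l0); congr projective.
by rewrite /act /=; congr (_, _); ring.
Qed.

Lemma mobius1 z : mobius 1%:M z = z.
Proof.
by rewrite mobiusE; case: z => [t|]; rewrite /projective /act !mxE /= ?mul1r ?mul0r ?add0r
   ?addr0 ?oner_eq0 ?divr1 ?eqxx ?mulr0.
Qed.

Lemma mobiusK M : \det M = 1 -> cancel (mobius M) (mobius (invmx M)).
Proof.
move=> dM z; rewrite -mobiusM ?mulVmx ?mobius1 ?unitmxE ?dM ?unitr1 //.
by rewrite det_inv dM invr1.
Qed.

Variable A : subringClosed R.

Lemma SL2M M N : SL2 A M -> SL2 A N -> SL2 A (M *m N).
Proof.
move=> [AM dM] [AN dN]; split; last by rewrite det_mulmx dM dN mulr1.
by apply/mxOverP => i j; rewrite mulmx2E rpredD // rpredM //; exact/mxOverP.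
Qed.

Lemma SL2V M : SL2 A M -> SL2 A (invmx M).
Proof.
move=> [AM dM]; split; last by rewrite det_inv dM invr1.
rewrite /invmx unitmxE dM unitr1 invr1 scale1r.
apply/mxOverP => i j; rewrite mxE /cofactor det_mx11 !mxE rpredM ?rpredX ?rpredN1 //.
exact/mxOverP.
Qed.

Lemma SL2_1 : SL2 A 1%:M.
Proof.
split; last exact: det1.
by apply/mxOverP => i j; rewrite mxE; case: (i == j); rewrite ?rpred1 ?rpred0.
Qed.

(** Conjugates of hyperbolic elements are hyperbolic. *)
Lemma PA_mobius M z : SL2 A M -> PA A z -> PA A (mobius M z).
Proof.
move=> AM [N [AN hN zN]]; exists (M *m N *m invmx M); split.
- by apply: SL2M; [exact: SL2M|exact: SL2V].
- rewrite /hyperbolic mxtrace_mulC mulmxA mulVmx ?mul1mx //.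
  by rewrite unitmxE AM.2 unitr1.
- have dV : \det (invmx M) = 1 by rewrite det_inv AM.2 invr1.
  by rewrite !mobiusM ?det_mulmx ?AM.2 ?AN.2 ?mulr1 // mobiusK ?zN // AM.2.
Qed.

End Mobius.

(* The set of points between two points of the projective line, not the
   subsequence of a cyclic sequence. *)
Local Notation arc := Defs.arc.

(** * Arcs and piecewise projective homeomorphisms *)

Section Arcs.
Variable R : realType.
Implicit Types (z w p q : P1 R) (E I : set (P1 R)).

(** An increasing embedding of the line into [-1, 1], with infinity on top.
    It turns cyclic order on the projective line into inequalities between
    real numbers. *)
Definition height z : R := if z is Some t then t / (1 + `|t|) else 1.

Lemma height_lt (s t : R) : (height (Some s) < height (Some t)) = (s < t).
Proof.
have pos (u : R) : 0 < 1 + `|u| by have := normr_ge0 u; lra.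
rewrite /height ltr_pdivrMr // mulrAC ltr_pdivlMr //.
case: (ger0P s) => s0; case: (ger0P t) => t0;
  by apply/idP/idP => h; nra.
Qed.

Lemma height_lt1 (t : R) : height (Some t) < 1.
Proof.
have := ler_norm t; have := normr_ge0 t => t0 t1.
by rewrite /height ltr_pdivrMr; lra.
Qed.

Lemma height_inj : injective height.
Proof.
move=> [s|] [t|] // e; first last.
- by have := height_lt1 t; rewrite -e ltxx.
- by have := height_lt1 s; rewrite e ltxx.
congr Some; apply/eqP; rewrite eq_le !leNgt.
by rewrite -(height_lt t s) -(height_lt s t) e !ltxx.
Qed.

(** The arc from [a] to [b] in increasing direction, through the top if [b <
    a]. *)
Definition between (a b c : R) : Prop := if a <= b then is_true (a <= c <= b) else a <= c \/ c <= b.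

Lemma arcE p q z : arc p q z <-> between (height p) (height q) (height z).
Proof.
have le1 (t : R) := height_lt1 t.
have leE (s t : R) : (height (Some s) <= height (Some t)) = (s <= t).
  by rewrite !leNgt height_lt.
have leN (t : R) : (height (Some t) <= height None) = true by rewrite ltW // le1.
have geN (t : R) : (height None <= height (Some t)) = false.
  by apply/negbTE; rewrite -ltNge le1.
rewrite /between; case: p q z => [x|] [y|] [t|] /=.
- rewrite leE; case: ifP => xy; rewrite !leE.
    by split=> [[s /= h [<-]]|h]; last exists t.
  split=> [[//|[s /= /orP h [<-]]]|h]; first exact: h.
  by right; exists t => //; apply/orP.
- rewrite leE; case: ifP => xy; rewrite leN geN.
    by split=> [[]|].
  by split=> _; left.
- rewrite !leN leE andbT.
  by split=> [[//|[s /= h [<-]]]//|h]; right; exists t.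
- by rewrite leN lexx; split=> // _; left.
- rewrite !geN leE; split=> [[//|[s /= h [<-]]]|[//|h]]; first by right.
  by right; exists t.
- by rewrite !geN; split=> _; left.
- by rewrite lexx geN; split.
- by rewrite !lexx; split.
Qed.

Definition inside (a b c : R) : Prop := [/\ between a b c, c != a & c != b].

Lemma between_cut a b e c : a != b -> inside a b e ->
  (between a b c <-> between a e c \/ between e b c).
Proof.
rewrite /inside /between => /eqP ab [] he /eqP ae /eqP eb.
by move: he; case: (leP a b) => h1; case: (leP a e) => h2; case: (leP e b) => h3 he;
  split; move=> h; lra.
Qed.

Lemma inside_cut a b e c : a != b -> inside a b e ->
  inside a e c \/ inside e b c -> inside a b c.
Proof.
rewrite /inside /between => /eqP ab [] he /eqP ae /eqP eb h.
suff : (if a <= b then is_true (a <= c <= b) else a <= c \/ c <= b) /\ (c <> a /\ c <> b).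
  by case=> ? [/eqP ? /eqP ?].
by move: he h; case: (leP a b) => h1; case: (leP a e) => h2; case: (leP e b) => h3 he;
  case=> -[h4 /eqP h5 /eqP h6]; split; try lra; split; lra.
Qed.

Lemma between_side a b e1 e2 : a != b -> e1 < e2 -> ~ inside a b e1 -> ~ inside a b e2 ->
  (forall c, between a b c -> between e1 e2 c) \/
  (forall c, between a b c -> between e2 e1 c).
Proof.
move=> /eqP ab e12 n1 n2.
have out e : ~ inside a b e -> e = a \/ e = b \/ ~ between a b e.
  move=> ne; have [->|ea] := eqVneq e a; first by left.
  have [->|eb] := eqVneq e b; [by right; left|right; right=> he].
  by apply: ne; split.
rewrite /between (ltW e12) (_ : (e2 <= e1) = false); last by apply/negbTE; rewrite -ltNge.
have := out _ n1; have := out _ n2; rewrite /between.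
case: (leP a b) => h1 o2 o1; last by right => c; lra.
have [h2|h2] := leP e1 a; last by right => c; lra.
by have [h3|h3] := leP b e2; [left|right] => c; lra.
Qed.

(** The last clause says that a cut makes no point an inner point, so that
    cuts at several points can be made one after the other. *)
Lemma arc_cut E p q e : E p -> E q -> E e -> p != q ->
  exists c : bool -> P1 R * P1 R,
  [/\ forall b, [/\ E (c b).1, E (c b).2 & (c b).1 != (c b).2],
      forall z, arc p q z <-> exists b, arc (c b).1 (c b).2 z,
      forall b, ~ inside (height (c b).1) (height (c b).2) (height e)
    & forall b (t : R), inside (height (c b).1) (height (c b).2) t ->
                  inside (height p) (height q) t].
Proof.
move=> Ep Eq Ee pq; have hpq : height p != height q by rewrite (inj_eq height_inj).
have [he|he] := pselect (inside (height p) (height q) (height e)); last first.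
  exists (fun=> (p, q)); split=> // z; split=> [h|[//]]; by exists true.
have [_ ep eq] := he; rewrite !(inj_eq height_inj) in ep eq.
exists (fun b : bool => if b then (p, e) else (e, q)); split.
- by case; split; rewrite //= eq_sym.
- move=> z; rewrite arcE (between_cut _ hpq he) -!arcE; split=> [[h|h]|[[] h]].
  + by exists true.
  + by exists false.
  + by left.
  + by right.
- by case=> -[/= _]; rewrite eqxx.
- by case=> z h; apply: (inside_cut hpq he); [left|right].
Qed.

(** Intersecting with the two arcs between [e1] and [e2] could produce
    isolated points, which are not allowed as intervals; cutting at [e1] and
    then at [e2] avoids this. *)
Lemma closed_interval_split E I e1 e2 : E e1 -> E e2 -> height e1 < height e2 ->
  closed_interval E I ->
  exists J : bool * bool -> set (P1 R),
  [/\ forall b, closed_interval E (J b), forall z, I z <-> exists b, J b z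
    & forall b, J b `<=` arc e1 e2 \/ J b `<=` arc e2 e1].
Proof.
move=> E1 E2 e12; have e1n2 : e1 != e2.
  by apply: contraTneq e12 => ->; rewrite ltxx.
case=> [->|[p [q [Ep Eq pq ->]]]].
  exists (fun b => if b.1 then arc e1 e2 else arc e2 e1); split.
  - case=> -[] _ /=; right; [exists e1, e2|exists e2, e1]; split=> //; by rewrite eq_sym.
  - move=> z; split=> // _.
    have [h|h] : arc e1 e2 z \/ arc e2 e1 z.
      rewrite !arcE /between (ltW e12) (_ : (height e2 <= height e1) = false); first lra.
      by apply/negbTE; rewrite -ltNge.
    + by exists (true, true).
    + by exists (false, true).
  - by case=> -[] _ /=; [left|right].
have [c [cE cz c1 cin]] := arc_cut Ep Eq E1 pq.
have /choice[d dP] : forall b, exists d : bool -> P1 R * P1 R,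
  [/\ forall b', [/\ E (d b').1, E (d b').2 & (d b').1 != (d b').2],
      forall z, arc (c b).1 (c b).2 z <-> exists b', arc (d b').1 (d b').2 z,
      forall b', ~ inside (height (d b').1) (height (d b').2) (height e2)
    & forall b' (t : R), inside (height (d b').1) (height (d b').2) t ->
                  inside (height (c b).1) (height (c b).2) t].
  by move=> b; have [? ? ?] := cE b; exact: arc_cut.
exists (fun b => arc (d b.1 b.2).1 (d b.1 b.2).2); split.
- move=> [b b'] /=; have [/(_ b')[? ? ?] _ _ _] := dP b; right.
  by exists (d b b').1, (d b b').2.
- move=> z; rewrite cz; split=> [[b]|[[b b'] h]].
    by have [_ -> _ _] := dP b => -[b' h]; exists (b, b').
  by exists b; have [_ -> _ _] := dP b; exists b'.
- move=> [b b'] /=; have [/(_ b')[_ _ dd] _ d2 din] := dP b.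
  have hd : height (d b b').1 != height (d b b').2 by rewrite (inj_eq height_inj).
  have n1 : ~ inside (height (d b b').1) (height (d b b').2) (height e1).
    by move=> /din; exact: c1.
  by case: (between_side hd e12 n1 (d2 b')) => h; [left|right] => z /arcE/h/arcE.
Qed.
End Arcs.

Section TwoPieces.
Variables (R : realType) (A : subringClosed R).

Lemma piecewise_fin (J : finType) (I : J -> set (P1 R)) (M : J -> 'M[R]_2) (f : homeo (P1 R)) :
  (forall j, closed_interval (PA A) (I j)) -> (forall z, exists j, I j z) ->
  (forall j, SL2 A (M j)) -> (forall j z, I j z -> f z = mobius (M j) z) ->
  piecewise_PSL2 A f.
Proof.
move=> cI IT AM fM; exists #|J|, (I \o enum_val), (M \o enum_val); split=> //=.
- by apply/seteqP; split=> // z _; have [j jz] := IT z;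
    exists (enum_rank j) => //=; rewrite enum_rankK.
- by move=> i z; exact: fM.
Qed.

(** One matrix on a compact interval and another one outside, infinity
    included: for left multiplication by such a map, the pieces of an
    element of [Hgroup A] have to be cut at two points only. *)
Definition two_pieces (s : homeo R) : Prop :=
  exists a b M N, [/\ a < b, PA A (Some a), PA A (Some b), SL2 A M & SL2 A N] /\
  [/\ {homo s : u v / u < v},
      forall z, arc (Some a) (Some b) z -> homeo_opc s z = mobius M z
    & forall z, arc (Some b) (Some a) z -> homeo_opc s z = mobius N z].

Lemma arc_Some (p q t : R) : p < q ->
  (arc (Some p) (Some q) (Some t) = (p <= t <= q)) *
  (arc (Some q) (Some p) (Some t) = (q <= t \/ t <= p)).
Proof.
move=> pq; rewrite /= (ltW pq) [q <= p]leNgt pq /=; split; apply/propext; split.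
- by move=> [u /= h [<-]].
- by move=> h; exists t.
- by move=> [//|[u /= /orP h [<-]]].
- by move=> h; right; exists t => //; apply/orP.
Qed.

Lemma arc_None (p q : R) : p < q ->
  ~ arc (Some p) (Some q) (None : P1 R) /\ arc (Some q) (Some p) (None : P1 R).
Proof.
move=> pq; rewrite /= (ltW pq) [q <= p]leNgt pq /=; split; first by case.
by left.
Qed.

Lemma two_piecesV s : two_pieces s -> two_pieces s^-1%g.
Proof.
move=> [a [b [M [N [[ab Ea Eb AM AN] [sinc sM sN]]]]]].
have smono := leW_mono (le_mono sinc); have slemono := le_mono sinc.
have sab : s a < s b by rewrite smono.
have piece p q P z : (p = a /\ q = b) \/ (p = b /\ q = a) ->
    SL2 A P -> (forall w, arc (Some p) (Some q) w -> homeo_opc s w = mobius P w) ->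
    arc (Some (s p)) (Some (s q)) z -> homeo_opc s^-1%g z = mobius (invmx P) z.
  move=> pq AP sP; set w := homeo_opc _ z => zpq.
  have zE : z = homeo_opc s w.
    by rewrite /w; case: (z) => [t|] //=; rewrite homeo_invK.
  suff wpq : arc (Some p) (Some q) w.
    by rewrite zE (sP _ wpq) mobiusK // AP.2.
  move: zpq; rewrite zE; case: (w) => [t|];
    rewrite -?[homeo_opc s (Some t)]/(Some (s t)); case: pq => -[-> ->].
  - by rewrite (arc_Some _ sab).1 (arc_Some _ ab).1 !slemono.
  - by rewrite (arc_Some _ sab).2 (arc_Some _ ab).2 !slemono.
  - by move=> /(arc_None sab).1.
  - by move=> _; exact: (arc_None ab).2.
exists (s a), (s b), (invmx M), (invmx N); split; split=> //.
- rewrite -[Some (s a)]/(homeo_opc s (Some a)) sM ?(arc_Some _ ab).1 ?lexx ?ltW //.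
  exact: PA_mobius.
- rewrite -[Some (s b)]/(homeo_opc s (Some b)) sM ?(arc_Some _ ab).1 ?lexx ?ltW //.
  exact: PA_mobius.
- exact: SL2V.
- exact: SL2V.
- move=> u v uv; rewrite -smono -[s _]/(s (homeo_inv s u)).
  by rewrite -[s (_ v)]/(s (homeo_inv s v)) !homeo_invK.
- by move=> z; apply: piece => //; left.
- by move=> z; apply: piece => //; right.
Qed.

(** The pieces of the element of [Hgroup A] are cut at the preimages of the
    two breakpoints of [s]; on each resulting arc the product is given by a
    product of two matrices. *)
Lemma two_pieces_mul s g : two_pieces s -> Hgroup A g -> Hgroup A (s * g)%g.
Proof.
move=> [a [b [M [N [[ab Ea Eb AM AN] [sinc sM sN]]]]]] [f [[n [I [P [cI IT AP fP]]]] fN fg]].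
exists (homeo_opc s * f)%g; split; last 2 first.
- by rewrite -[LHS]/(homeo_opc s (f None)) fN.
- by move=> t; rewrite -[LHS]/(homeo_opc s (f (Some t))) fg.
have EV t : PA A (Some (g t)) -> PA A (Some t).
  move=> Eg; have [i _ iz] : (\bigcup_i I i) (Some t) by rewrite IT.
  have gt : mobius (P i) (Some t) = Some (g t) by rewrite -fg (fP i).
  by rewrite -(mobiusK (AP i).2 (Some t)) gt; apply: PA_mobius => //; exact: SL2V.
have EgV t : PA A (Some t) -> PA A (Some (homeo_inv g t)).
  by move=> Et; apply: EV; rewrite homeo_invK.
(* [g] may reverse the orientation, which exchanges the two preimages *)
have [lo [hi [lohi Elo Ehi gin gout]]] : exists lo hi, [/\ lo < hi, PA A (Some lo),
    PA A (Some hi), forall t, lo <= t <= hi -> a <= g t <= b &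
    forall t, hi <= t \/ t <= lo -> b <= g t \/ g t <= a].
  have gI := can_inj (homeo_funK g).
  have nab : a < b -> homeo_inv g a <> homeo_inv g b.
    by move=> ab' /(can_inj (homeo_invK g)) e; move: ab'; rewrite e ltxx.
  have [gh|gh] := homeo_mono g.
  - exists (homeo_inv g a), (homeo_inv g b); split; try exact: EgV.
    + by rewrite ltNge; apply/negP => /gh; rewrite !homeo_invK; lra.
    + by move=> t /andP[/gh + /gh]; rewrite !homeo_invK => -> ->.
    + by move=> t [/gh|/gh]; rewrite !homeo_invK; [left|right].
  - exists (homeo_inv g b), (homeo_inv g a); split; try exact: EgV.
    + by rewrite ltNge; apply/negP => /gh; rewrite !homeo_invK; lra.
    + by move=> t /andP[/gh + /gh]; rewrite !homeo_invK !lerN2 => -> ->.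
    + by move=> t [/gh|/gh]; rewrite !homeo_invK !lerN2; [right|left].
have fin z : arc (Some lo) (Some hi) z -> arc (Some a) (Some b) (f z).
  case: z => [t|]; last by move=> /(arc_None lohi).1.
  by rewrite fg (arc_Some _ lohi).1 (arc_Some _ ab).1; exact: gin.
have fout z : arc (Some hi) (Some lo) z -> arc (Some b) (Some a) (f z).
  case: z => [t|]; last by move=> _; rewrite fN; exact: (arc_None ab).2.
  by rewrite fg (arc_Some _ lohi).2 (arc_Some _ ab).2; exact: gout.
have hlohi : height (Some lo) < height (Some hi) by rewrite height_lt.
have /choice[J JP] := fun i => closed_interval_split Elo Ehi hlohi (cI i).
have /choice[Q QP] : forall k : 'I_n * (bool * bool), exists Q, SL2 A Q /\
    forall z, J k.1 k.2 z -> homeo_opc s (f z) = mobius Q z.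
  move=> [i c] /=; have [_ Jz /(_ c) Jside] := JP i.
  have JI z : J i c z -> I i z by move=> Jcz; rewrite Jz; exists c.
  case: Jside => side.
  - exists (M *m P i); split; first exact: SL2M.
    move=> z Jcz; rewrite mobiusM ?AM.2 ?(AP i).2 // -fP; last exact: JI.
    by apply/sM/fin/side.
  - exists (N *m P i); split; first exact: SL2M.
    move=> z Jcz; rewrite mobiusM ?AN.2 ?(AP i).2 // -fP; last exact: JI.
    by apply/sN/fout/side.
apply: (@piecewise_fin _ (fun k => J k.1 k.2) Q).
- by case=> i c; have [+ _ _] := JP i; apply.
- move=> z; have [i _ iz] : (\bigcup_i I i) z by rewrite IT.
  by have [_ /(_ z)[+ _] _] := JP i => /(_ iz)[c cz]; exists (i, c).
- by move=> k; case: (QP k).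
- by move=> k z; case: (QP k) => _; apply.
Qed.

Lemma Hgroup1 : Hgroup A 1%g.
Proof.
exists 1%g; split=> //; apply: (@piecewise_fin unit (fun=> setT) (fun=> 1%:M)).
- by move=> _; left.
- by move=> z; exists tt.
- by move=> _; exact: SL2_1.
- by move=> _ z _; rewrite mobius1.
Qed.
End TwoPieces.

(** * Twists in the groups H(A) *)

Section Fraction.
Variable R : realType.
Implicit Types a b c d s t u : R.

(** A real form of [mobius], where the denominator is positive. *)
Definition frac a b c d t : R := (a * t + b) / (c * t + d).

Lemma frac_le a b c d s t : a * d - b * c = 1 -> 0 < c * s + d -> 0 < c * t + d ->
  (frac a b c d s <= frac a b c d t) = (s <= t).
Proof.
move=> det s0 t0; rewrite /frac ler_pdivrMr // mulrAC ler_pdivlMr // -subr_ge0.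
rewrite -[RHS]subr_ge0; congr (0 <= _).
by rewrite -[RHS]mul1r -det; ring.
Qed.

Lemma fracK a b c d t : a * d - b * c = 1 -> 0 < c * t + d ->
  0 < - c * frac a b c d t + a /\ frac d (- b) (- c) a (frac a b c d t) = t.
Proof.
move=> det t0; have tn := lt0r_neq0 t0.
have E : - c * frac a b c d t + a = (c * t + d)^-1.
  by apply: (mulIf tn); rewrite mulVf // -det /frac; field.
split; first by rewrite E invr_gt0.
rewrite /frac -/(frac a b c d t) E invrK -[RHS]mulr1 -det /frac; field.
exact: tn.
Qed.

(** The fraction and the translation [t - 1] agree at [p] and [q], and the
    pole of the fraction is to the left of [p]. *)
Lemma glued_homeo a b c d p q : a * d - b * c = 1 -> 0 < c -> p < q ->
  0 < c * p + d -> frac a b c d p = p - 1 -> frac a b c d q = q - 1 ->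
  exists2 s : homeo R, {homo s : u v / u < v} &
    forall t, s t = if p <= t <= q then frac a b c d t else t - 1.
Proof.
move=> det c0 pq dp fp fq.
have dpos t : p <= t -> 0 < c * t + d.
  by move=> pt; apply: lt_le_trans dp _; rewrite lerD2r ler_pM2l.
have det' : d * a - (- b) * (- c) = 1 by rewrite -det; ring.
have dq := dpos q (ltW pq).
have [ep Wp] := fracK det dp; have [eq Wq] := fracK det dq.
rewrite fp in ep Wp; rewrite fq in eq Wq.
have epos u : u <= q - 1 -> 0 < - c * u + a.
  by move=> uq; apply: lt_le_trans eq _; rewrite lerD2r ler_nM2l // oppr_lt0.
pose f t := if p <= t <= q then frac a b c d t else t - 1.
pose g u := if p - 1 <= u <= q - 1 then frac d (- b) (- c) a u else u + 1.
have fin t : p <= t <= q -> p - 1 <= frac a b c d t <= q - 1.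
  by move=> /andP[pt tq]; rewrite -fp -fq !frac_le ?pt ?tq // dpos.
have gin u : p - 1 <= u <= q - 1 -> p <= frac d (- b) (- c) a u <= q.
  move=> /andP[pu uq]; have pq1 : p - 1 <= q - 1 by lra.
  apply/andP; split.
    by rewrite -[leLHS]Wp frac_le //; exact: epos.
  by rewrite -[leRHS]Wq frac_le //; exact: epos.
have fK : cancel f g.
  move=> t; rewrite /f; case: ifP => tpq; rewrite /g.
    by rewrite fin // (fracK det _).2 //; apply: dpos; case/andP: tpq.
  by rewrite !lerD2r tpq subrK.
have gK : cancel g f.
  move=> u; rewrite /g; case: ifP => upq; rewrite /f.
    rewrite gin //; have [_] := fracK det' (epos u (proj2 (andP upq))).
    by rewrite !opprK.
  by rewrite -[p <= _]lerBlDr -[_ <= q]lerBrDr upq addrK.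
have finc : {homo f : u v / u < v}.
  have lt u v : p <= u <= q -> p <= v <= q -> u < v -> frac a b c d u < frac a b c d v.
    by move=> /andP[pu _] /andP[pv _] uv; rewrite ltNge frac_le ?dpos // -ltNge.
  move=> u v uv; rewrite /f; case: ifP => hu; case: ifP => hv.
  - exact: lt.
  - have := fin u hu; move: hu hv; case: (leP p v); case: (leP v q); lra.
  - have := fin v hv; move: hu hv; case: (leP p u); case: (leP u q); lra.
  - lra.
by exists (incr_homeo fK gK finc).
Qed.

(** The fixed points of [t |-> frac a b c d t + 1] are the roots of a
    quadratic polynomial with positive leading coefficient, which is
    negative at 0 and at 1 because [0 < b + d] and [0 < a + b]. The trace [a
    + c + d] of this map being larger than 2, both roots are to the right of
    the pole. *)
Lemma fixed_points a b c d : a * d - b * c = 1 -> 0 < c -> 0 < d -> 0 < b + d -> 0 < a + b ->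
  2 < a + c + d ->
  exists p q, [/\ p < 0, 1 < q, 0 < c * p + d, frac a b c d p = p - 1 &
    frac a b c d q = q - 1].
Proof.
move=> det c0 d0 bd ab acd.
pose D := (a + c - d) ^+ 2 + 4 * c * (b + d); pose r := Num.sqrt D.
have rr : r ^+ 2 = D by rewrite sqr_sqrtr // addr_ge0 ?sqr_ge0 // ltW // mulr_gt0 //; lra.
have r0 : 0 <= r by exact: sqrtr_ge0.
pose p := (a + c - d - r) / (2 * c); pose q := (a + c - d + r) / (2 * c).
have c2 : 0 < 2 * c by lra.
have cn : c != 0 by rewrite gt_eqF.
have cbd : 0 < c * (b + d) by rewrite mulr_gt0.
have cab : 0 < c * (a + b) by rewrite mulr_gt0.
have p0 : p < 0.
  rewrite /p ltr_pdivrMr // mul0r subr_lt0.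
  by rewrite ltNge; apply/negP => h; move: rr; rewrite /D; nra.
have q1 : 1 < q.
  rewrite /q ltr_pdivlMr // mul1r.
  by rewrite ltNge; apply/negP => h; move: rr; rewrite /D; nra.
have pE : 2 * c * p = a + c - d - r by rewrite /p mulrC divfK // gt_eqF.
have qE : 2 * c * q = a + c - d + r by rewrite /q mulrC divfK // gt_eqF.
have root z : (z = p \/ z = q) -> a * z + b = (z - 1) * (c * z + d).
  move=> zE; have : (2 * c * z - (a + c - d)) ^+ 2 = D.
    by case: zE => ->; rewrite ?pE ?qE -rr; ring.
  rewrite /D => h; have : 4 * c * ((z - 1) * (c * z + d) - (a * z + b)) = 0.
    rewrite (_ : _ * _ = (2 * c * z - (a + c - d)) ^+ 2 -
       ((a + c - d) ^+ 2 + 4 * c * (b + d))); last by ring.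
    by rewrite h subrr.
  by move/eqP; rewrite !mulf_eq0 pnatr_eq0 (negbTE cn) /= subr_eq0 => /eqP.
have rp := root p (or_introl erefl); have rq := root q (or_intror erefl).
have dp : 0 < c * p + d.
  rewrite ltNge; apply/negP => h.
  have : c * (a * p + b) - a * (c * p + d) = - 1 by rewrite -det; ring.
  rewrite rp => h1.
  have : (c * (p - 1) - a) * (c * p + d) = -1 by rewrite -[RHS]h1; ring.
  have : a + c - c * p > 0 by lra.
  nra.
have dq : 0 < c * q + d by rewrite addr_gt0 // mulr_gt0 //; lra.
exists p, q; split=> //; rewrite /frac.
  by rewrite rp mulfK // gt_eqF.
by rewrite rq mulfK // gt_eqF.
Qed.
End Fraction.

Section Elements.
Variables (R : realType) (A : subringClosed R).

Definition mx22 (a b c d : R) : 'M[R]_2 := \matrix_(i, j)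
  if i == 0 then if j == 0 then a else b else if j == 0 then c else d.

Lemma SL2_mx22 a b c d : a \in A -> b \in A -> c \in A -> d \in A ->
  a * d - b * c = 1 -> SL2 A (mx22 a b c d).
Proof.
move=> Aa Ab Ac Ad det; split; last by rewrite det2E !mxE.
by apply/mxOverP => i j; rewrite mxE; do 2 case: ifP.
Qed.

Lemma mobius_mx22 a b c d t : c * t + d != 0 ->
  mobius (mx22 a b c d) (Some t) = Some (frac a b c d t).
Proof. by move=> t0; rewrite /mobius !mxE /= (negbTE t0). Qed.

Lemma glued_two_pieces a b c d : a \in A -> b \in A -> c \in A -> d \in A ->
  a * d - b * c = 1 -> 0 < c -> 0 < d -> 0 < b + d -> 0 < a + b -> 2 < a + c + d ->
  exists2 s : homeo R, two_pieces A s & forall t, 0 <= t <= 1 -> s t = frac a b c d t.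
Proof.
move=> Aa Ab Ac Ad det c0 d0 bd ab acd.
have [p [q [p0 q1 dp fp fq]]] := fixed_points det c0 d0 bd ab acd.
have pq : p < q by lra.
have [s sinc sE] := glued_homeo det c0 pq dp fp fq.
exists s; last by move=> t t01; rewrite sE ifT //; lra.
have dpos t : p <= t -> 0 < c * t + d.
  by move=> pt; apply: lt_le_trans dp _; rewrite lerD2r ler_pM2l.
have Efix t : p <= t -> frac a b c d t = t - 1 -> PA A (Some t).
  move=> pt ft; have tn := lt0r_neq0 (dpos t pt); exists (mx22 (a + c) (b + d) c d); split.
  - by apply: SL2_mx22; rewrite ?rpredD // -det; ring.
  - rewrite /hyperbolic /mxtrace !big_ord_recl big_ord0 !mxE /=; apply: lt_le_trans (ler_norm _).
    lra.
  - rewrite mobius_mx22 //; congr Some.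
    have -> : frac (a + c) (b + d) c d t = frac a b c d t + 1 by rewrite /frac; field.
    by rewrite ft subrK.
exists p, q, (mx22 a b c d), (mx22 1 (- 1) 0 1); split; split=> //.
- exact: Efix.
- by apply: Efix => //; exact: ltW.
- exact: SL2_mx22.
- by apply: SL2_mx22; rewrite ?rpred1 ?rpred0 ?rpredN1 //; ring.
- move=> [t|]; last by move/(arc_None pq).1.
  rewrite (arc_Some _ pq).1 => tpq; rewrite mobius_mx22; last first.
    by apply/lt0r_neq0/dpos; case/andP: tpq.
  by rewrite -[LHS]/(Some (s t)) sE tpq.
- move=> [t|]; last by move=> _; rewrite /mobius !mxE /= eqxx.
  rewrite (arc_Some _ pq).2 => tpq.
  rewrite mobius_mx22 /frac ?mul0r ?add0r ?oner_eq0 // divr1 mul1r.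
  rewrite -[LHS]/(Some (s t)) sE; case: ifP => // /andP[pt tq].
  by case: tpq => h; [rewrite (_ : t = q) ?fq // | rewrite (_ : t = p) ?fp //];
    apply/eqP; rewrite eq_le ?pt ?tq h.
Qed.

(** The coefficients are those of the matrix of the twist in the coordinate
    [t]; its lower left one is [x - 2 y - x y^2], positive because [y <= x /
    8]. *)
Lemma twist_two_pieces x i : x \in A -> 0 < x <= 8^-1 ->
  exists2 s : homeo R, two_pieces A s & forall t, 0 <= t <= 1 -> s t = twist (offset x i) x t.
Proof.
move=> Ax hx; have [x0 x8 y0 y8] := small_twist_offset i hx.
have Ay : offset x i \in A by rewrite rpredX.
move: (offset x i) y0 y8 Ay => y y0 y8 Ay.
have xy0 : 0 < x * y by rewrite mulr_gt0.
have xyy0 : 0 < x * y * y by rewrite mulr_gt0.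
have y64 : y <= 64^-1 by lra.
have xyy : x * y * y <= x * y by rewrite ler_piMr ?ltW //; lra.
have xy : x * y <= x / 64 by rewrite ler_pM2l.
have [||||||||||s ts sE] := @glued_two_pieces (1 + x * y - (2 * y + x * y * y)) (2 * y + x * y * y)
  (x - (2 * y + x * y * y)) (1 + x * y + (2 * y + x * y * y)).
- by rewrite !(rpredB, rpredD, rpred1, rpredM, rpredMn).
- by rewrite !(rpredB, rpredD, rpred1, rpredM, rpredMn).
- by rewrite !(rpredB, rpredD, rpred1, rpredM, rpredMn).
- by rewrite !(rpredB, rpredD, rpred1, rpredM, rpredMn).
- by ring.
- lra.
- lra.
- lra.
- lra.
- lra.
exists s => // t t01; rewrite sE // /frac /twist /chart /twist_vec /ushear /lshear /=.
by congr (_ / _); ring.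
Qed.

Lemma Hgroup_paradoxical : dense [set` A] -> paradoxical (Hgroup A) 4 4.
Proof.
move=> dA; have [b [b01 Ab]] : (`]0, 1[%classic `&` [set` A]) !=set0.
  apply: dA; first by exists 2^-1; rewrite /= in_itv /=; lra.
  exact: interval_open.
rewrite /= in_itv /= in b01.
have [k hx avx] := small_power_avoiding_roots b01.
have Ax : b ^+ k \in A by rewrite rpredX.
have /choice[h hP] : forall i : 'I_4, exists s : homeo R, two_pieces A s /\
    forall t, 0 <= t <= 1 -> s t = twist (offset (b ^+ k) i) (b ^+ k) t.
  by move=> i; have [s ? ?] := twist_two_pieces i Ax hx; exists s.
apply: (twisting_paradoxical hx avx (h := h)).
- by move=> i t; case: (hP i) => _; apply.
- exact: Hgroup1.
- by move=> i g; apply: two_pieces_mul; case: (hP i).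
- by move=> i g; apply: two_pieces_mul; apply: two_piecesV; case: (hP i).
Qed.
End Elements.


Theorem theorem0p1 (R : realType) :
  (forall A : subringClosed R, dense [set` A] ->
     exists2 k : nat, is_tarski_number (Hgroup A) k & (k <= 25)%N) /\
  (exists2 k : nat, is_tarski_number (LM_G0 R) k & (k <= 25)%N) /\
  (exists2 k : nat, is_tarski_number (LM_G R) k & (k <= 25)%N).
Proof.
have bound (L : set (homeo R)) : paradoxical L 4 4 ->
    exists2 k, is_tarski_number L k & (k <= 25)%N.
  by move=> /paradoxical_tarski[k kL k8]; exists k => //; exact: leq_trans k8 _.
split; first by move=> A dA; apply/bound/Hgroup_paradoxical.
by split; apply: bound; [exact: LM_G0_paradoxical | exact: LM_G_paradoxical].
Qed.
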